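(* Let $T^{\mathrm o}=\sum_{\ell\ge0}\sum_{m=-\ell}^{\ell}a^{\mathrm o}_{\ell,m}Y_{\ell,m}$ be a random field in $L_2(\Omega\times\mathbb{S}^2)$, and set $A^{\mathrm o}_\ell:=\big(\sum_{m=-\ell}^{\ell}|a^{\mathrm o}_{\ell,m}|^2\big)^{1/2}$. Let $\varepsilon>0$ and let $(\beta_\ell)_{\ell\ge0}$ be a sequence of positive numbers. Let $\ell^*$ be the smallest integer such that $\sum_{\ell>\ell^*}\mathbb E[(A^{\mathrm o}_\ell)^2]\le\varepsilon^2/4$, and let $\lambda$ satisfy \[ 0\le\lambda<\frac{\varepsilon}{2\sqrt{\sum_{\ell=0}^{\ell^*}\beta_\ell^2}}. \] Let $T^{\mathrm r}=\sum_{\ell,m}a^{\mathrm r}_{\ell,m}Y_{\ell,m}$ be the regularized field whose coefficients (for each realization) minimize $\tfrac12\sum_{\ell,m}|a_{\ell,m}-a^{\mathrm o}_{\ell,m}|^2+\lambda\sum_{\ell}\beta_\ell\big(\sum_{m=-\ell}^{\ell}|a_{\ell,m}|^2\big)^{1/2}$. Then \[ \|T^{\mathrm o}-T^{\mathrm r}\|_{L_2(\Omega\times\mathbb{S}^2)}<\varepsilon. \]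
   Context: Random fields are maps $\Omega\times\mathbb{S}^2\to\mathbb{R}$ on a probability space $(\Omega,\mathcal F,\mathbb P)$, measurable w.r.t. $\mathcal F\otimes\mathcal B(\mathbb{S}^2)$; $L_2(\Omega\times\mathbb{S}^2)$ is the $L_2$ space for $\mathbb P\otimes\sigma$, with norm $\|T\|_{L_2(\Omega\times\mathbb{S}^2)}=\big(\mathbb E\int_{\mathbb{S}^2}|T|^2\,d\sigma\big)^{1/2}$, where $\sigma$ is the surface measure on $\mathbb{S}^2$ with $\sigma(\mathbb{S}^2)=4\pi$. $\{Y_{\ell,m}\}$ is the standard complex orthonormal basis of spherical harmonics and $a^{\mathrm o}_{\ell,m}=\int_{\mathbb{S}^2}T^{\mathrm o}\overline{Y_{\ell,m}}\,d\sigma$. Explicitly, $a^{\mathrm r}_{\ell,m}=(1-\lambda\beta_\ell/A^{\mathrm o}_\ell)a^{\mathrm o}_{\ell,m}$ if $A^{\mathrm o}_\ell>\lambda\beta_\ell$ and $a^{\mathrm r}_{\ell,m}=0$ otherwise. *)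

(* Defs.v *)
From HB Require Import structures.
From mathcomp Require Import all_boot all_order all_algebra.
From mathcomp Require Import all_classical all_reals all_analysis.
From mathcomp Require Import complex.

Set Implicit Arguments.
Unset Strict Implicit.
Unset Printing Implicit Defensive.

Import Order.TTheory GRing.Theory Num.Theory.
Import numFieldNormedType.Exports.

Local Open Scope classical_set_scope.
Local Open Scope ring_scope.

Section Sphere.
Variable R : realType.

Definition pt := ((R * R) * R)%type.

Definition px (p : pt) : R := p.1.1.
Definition py (p : pt) : R := p.1.2.
Definition pz (p : pt) : R := p.2.

Definition pnorm (p : pt) : R := Num.sqrt (px p ^+ 2 + py p ^+ 2 + pz p ^+ 2).

Definition sphere : set pt := [set p | pnorm p = 1].

Definition ball3 : set pt := [set p | 0 < pnorm p <= 1].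

Definition normalize (p : pt) : pt :=
  ((px p / pnorm p, py p / pnorm p), pz p / pnorm p).

Definition leb3 :=
  ((@lebesgue_measure R \x @lebesgue_measure R) \x @lebesgue_measure R)%E.

(* Integral over S^2 against the surface measure sigma (sigma(S^2) = 4 pi),
   defined by the cone formula  int_{S^2} f dsigma = 3 int_{B^3} f(x/|x|) dx. *)
Definition sphere_integral (f : pt -> R) : \bar R :=
  (3%:E * \int[leb3]_(p in ball3) (f (normalize p))%:E)%E.

(* Standard complex spherical harmonics (Condon--Shortley phase).
   For 0 <= m <= l, on the sphere:
     Y_{l,m} = (-1)^m N_{l,m} P_l^{(m)}(z) (x + i y)^m,
   with P_l = (2^l l!)^{-1} d^l/dz^l (z^2-1)^l (Rodrigues) and
     N_{l,m} = sqrt((2l+1)/(4 pi) (l-m)!/(l+m)!);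
   and Y_{l,-m} = (-1)^m conj(Y_{l,m}). *)
Definition rodrigues (l k : nat) : {poly R} :=
  ((('X ^+ 2 - 1) ^+ l) ^`(l + k)) .

Definition Ynorm (l m : nat) : R :=
  (-1) ^+ m * Num.sqrt ((2 * l + 1)%:R / (4 * pi) * (l - m)`!%:R / (l + m)`!%:R)
  / (2 ^ l * l`!)%:R.

Definition Ypos (l m : nat) (p : pt) : R[i] :=
  (real_complex R (Ynorm l m * (rodrigues l m).[pz p]) * (Complex (px p) (py p)) ^+ m)%R.

Definition Y (l : nat) (m : int) (p : pt) : R[i] :=
  if (0 <= m)%R then Ypos l `|m|%N p
  else ((-1) ^+ `|m|%N * conjc (Ypos l `|m|%N p))%R.

Definition midx (l : nat) (j : 'I_(2 * l + 1)) : int := (j%:Z - l%:Z)%R.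

Definition cabs2 (z : R[i]) : R := complex.Re z ^+ 2 + complex.Im z ^+ 2.

End Sphere.

Section Fields.
Context {d : measure_display} {Omega : measurableType d} {R : realType}.
Variable P : probability Omega R.

Definition random_field (T : Omega -> pt R -> R) : Prop :=
  measurable_fun (setT `*` @sphere R) (fun wp : Omega * pt R => T wp.1 wp.2).

Definition L2sq (T : Omega -> pt R -> R) : \bar R :=
  (\int[P]_w sphere_integral (fun p => ((T w p) ^+ 2)%R))%E.

Definition L2norm (T : Omega -> pt R -> R) : \bar R := poweR (L2sq T) (2^-1).

Definition L2dist_sq (T : Omega -> pt R -> R) (G : Omega -> pt R -> R[i]) : \bar R :=
  (\int[P]_w sphere_integral (fun p => cabs2 (real_complex R (T w p) - G w p)%R))%E.

(* a_{l,m}(w) = int_{S^2} T(w,.) conj(Y_{l,m}) dsigma *)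
Definition coef (T : Omega -> pt R -> R) (l : nat) (m : int) (w : Omega) : R[i] :=
  Complex (fine (sphere_integral (fun p => T w p * complex.Re (Y l m p))))
          (- fine (sphere_integral (fun p => T w p * complex.Im (Y l m p)))).

Definition Acoef (a : nat -> int -> Omega -> R[i]) (l : nat) (w : Omega) : R :=
  Num.sqrt (\sum_(j < 2 * l + 1) cabs2 (a l (midx j) w)).

(* regularized coefficients (group-lasso / block soft thresholding) *)
Definition reg_coef (lam : R) (beta : nat -> R) (a : nat -> int -> Omega -> R[i])
    (l : nat) (m : int) (w : Omega) : R[i] :=
  if lam * beta l < Acoef a l w
  then (real_complex R (1 - lam * beta l / Acoef a l w) * a l m w)%R
  else 0%R.

Definition psum (a : nat -> int -> Omega -> R[i]) (L : nat) (w : Omega) (p : pt R)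
    : R[i] :=
  (\sum_(l < L.+1) \sum_(j < 2 * l + 1) a l (midx j) w * Y l (midx j) p)%R.

Definition tailEA (a : nat -> int -> Omega -> R[i]) (k : nat) : \bar R :=
  (\sum_(k.+1 <= l <oo) \int[P]_w ((Acoef a l w) ^+ 2)%:E)%E.

End Fields.

(* Main.v *)
(* With R_l,m the (l+m)-th derivative of (z^2-1)^l, Y_l,m is a multiple of
   R_l,m(z) (x+iy)^m. A rotation about the z-axis kills the inner product of
   two harmonics of different order. For equal orders the inner product is the
   integral over the sphere of a polynomial in z, which equals 2 pi times its
   integral over [-1,1] (Archimedes), and l+m integrations by parts give
   orthonormality. Archimedes' formula is obtained from the moments M_n of z^n:
   comparing coefficients in the rotation invariance of (c z + s y)^n and using
   x^2+y^2+z^2 = 1 yields (n+1) M_n = (n-1) M_(n-2), and M_0 is the volume of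
   the ball.

   By orthonormality, the squared distance between the truncations of T^o and
   T^r is the sum over l of E[min(lam beta_l, A_l)^2], hence at most
   lam^2 sum_(l <= l-star) beta_l^2 + eps^2/4 < eps^2/2. The factor 2 to spare
   pays for replacing the Minkowski inequality by
   |u+v|^2 <= 2|u|^2 + 2|v|^2 in the passage to the limit. *)
Require Import Defs.
From HB Require Import structures.
From mathcomp Require Import all_boot all_order all_algebra.
From mathcomp Require Import all_classical all_reals all_analysis.
From mathcomp Require Import complex.
From mathcomp Require Import measurable_realfun ring lra zify.
Import Order.TTheory GRing.Theory Num.Theory.
Import numFieldNormedType.Exports.
Local Open Scope classical_set_scope.
Local Open Scope ring_scope.

(** * Legendre polynomials *)

(** Since the surface measure is given by the cone formula, each fact about the sphere becomes a
    fact about Lebesgue integrals, over the ball without its centre, of functions of x/|x|. Such an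
    integral is invariant under every volume preserving map that keeps the norm and commutes with
    normalization. Rotations preserve volume because they factor into shears, and a shear is a
    translation on each line parallel to an axis. This factorization divides by the sine of the
    angle, so multiples of pi are excluded throughout; that restriction dictates several choices of
    angles below. Ball integrals are one third of surface integrals, hence the constants 1/3 and 2/3
    pi where 1 and 2 pi would be expected. Both fields are tied to their coefficients only by L2
    convergence of partial sums, so the error bound has to be uniform in the truncation degree. *)

Section PolyIntegral.
Context {R : realType}.
Implicit Types p q g : {poly R}.

(* The integral of the polynomial function [q] over [[-1, 1]]. *)
Definition pint q : R :=
  \sum_(i < size q) q`_i * ((1 - (-1) ^+ i.+1) / i.+1%:R).

(** Padding with zero coefficients lets polynomials of different sizes share one index range. *)
Lemma pintE n q : (size q <= n)%N ->
  pint q = \sum_(i < n) q`_i * ((1 - (-1) ^+ i.+1) / i.+1%:R).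
Proof.
move=> qn; rewrite /pint (big_ord_widen_cond n xpredT
  (fun i => q`_i * ((1 - (-1) ^+ i.+1) / i.+1%:R)) qn) big_mkcond /=.
apply: eq_bigr => i _; case: ltnP => // iq.
by rewrite nth_default// mul0r.
Qed.

Lemma pint_linear (a : R) p q : pint (a *: p + q) = a * pint p + pint q.
Proof.
pose n := maxn (maxn (size p) (size q)) (size (a *: p + q)).
rewrite (@pintE n p) ?(@pintE n q) ?(@pintE n (_ + _)) ?leq_max ?leqnn ?orbT//.
rewrite mulr_sumr -big_split/=; apply: eq_bigr => i _.
rewrite coefD coefZ; ring.
Qed.

Lemma pintD p q : pint (p + q) = pint p + pint q.
Proof. by rewrite -[p]scale1r pint_linear scale1r mul1r. Qed.

Lemma pint0 : pint 0 = 0.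
Proof. by rewrite /pint size_poly0 big_ord0. Qed.

Lemma pintZ (a : R) p : pint (a *: p) = a * pint p.
Proof. by rewrite -[_ *: _]addr0 pint_linear pint0 addr0. Qed.

Lemma pint_deriv q : pint q^`() = q.[1] - q.[-1].
Proof.
rewrite (@pintE (size q)); last first.
  have [->|q0] := eqVneq q 0; first by rewrite deriv0 size_poly0.
  exact/ltnW/lt_size_deriv.
have -> : q.[1] - q.[-1] = \sum_(i < (size q).+1) q`_i * (1 - (-1) ^+ i).
  rewrite !horner_coef -sumrB big_ord_recr/= nth_default// mul0r addr0.
  by apply: eq_bigr => i _; rewrite expr1n mulrBr.
rewrite big_ord_recl/= expr0 subrr mulr0 add0r; apply: eq_bigr => i _.
rewrite coef_deriv -(mulr_natr q`_i.+1) /=.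
by rewrite /bump leq0n add1n; field; rewrite addrC natr1 pnatr_eq0.
Qed.

Lemma pint_by_parts p q :
  pint (q * p^`()) = (q * p).[1] - (q * p).[-1] - pint (q^`() * p).
Proof. by rewrite -pint_deriv derivM pintD addrAC subrr add0r. Qed.

Lemma pint_by_parts_iter n p q :
  (forall j, (j < n)%N -> (q^`(j) * p^`(n - j.+1)).[1] = 0) ->
  (forall j, (j < n)%N -> (q^`(j) * p^`(n - j.+1)).[-1] = 0) ->
  pint (q * p^`(n)) = (-1) ^+ n * pint (q^`(n) * p).
Proof.
elim: n q => [|n IH] q h1 hN1; first by rewrite expr0 mul1r !derivn0.
rewrite derivnS pint_by_parts.
have := h1 0%N (ltn0Sn _); have := hN1 0%N (ltn0Sn _).
rewrite derivn0 subSS subn0 => -> ->; rewrite subrr sub0r IH.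
- by rewrite exprS mulN1r mulNr derivSn.
- by move=> j jn; have := h1 j.+1 jn; rewrite derivSn subSS.
- by move=> j jn; have := hN1 j.+1 jn; rewrite derivSn subSS.
Qed.

(** This polynomial has two roles: its powers generate the Legendre polynomials, and on the sphere
    its value at z is -(x^2 + y^2). *)
Definition wpoly : {poly R} := 'X ^+ 2 - 1.

Lemma deriv_wpoly : wpoly^`() = 'X *+ 2.
Proof. by rewrite /wpoly derivB derivC subr0 derivXn expr1. Qed.

(** Each differentiation costs at most one factor [wpoly]. The cofactor [g] is there because the
    power later comes multiplied by a derivative. *)
Lemma derivn_wpoly_exp a j g : (j <= a)%N ->
  exists h, (wpoly ^+ a * g)^`(j) = wpoly ^+ (a - j) * h.
Proof.
elim: j => [|j IH] ja; first by exists g; rewrite derivn0 subn0.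
have [h eh] := IH (ltnW ja).
exists ((wpoly^`() * h) *+ (a - j) + wpoly * h^`()).
rewrite derivnS eh derivM deriv_exp mulrDr; congr (_ + _).
  by rewrite subnS; ring.
by rewrite mulrA -exprSr subnS prednK// subn_gt0.
Qed.

(** The endpoints 1 and -1 are roots of multiplicity at least [a]; this kills the boundary terms of
    the integrations by parts. *)
Lemma horner_derivn_wpoly_exp a j g x : x ^+ 2 = 1 -> (j < a)%N ->
  ((wpoly ^+ a * g)^`(j)).[x] = 0.
Proof.
move=> x2 ja; have [h ->] := @derivn_wpoly_exp a j g (ltnW ja).
rewrite hornerM horner_exp /wpoly hornerD hornerN hornerXn hornerC x2 subrr.
by rewrite expr0n subn_eq0 leqNgt ja mul0r.
Qed.

Lemma wpoly_exp_monic a : wpoly ^+ a \is monic.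
Proof. by rewrite monic_exp// /wpoly monic_Xn_sub_1. Qed.

Lemma size_wpoly_exp a : size (wpoly ^+ a) = (2 * a).+1.
Proof.
rewrite polySpred ?monic_neq0 ?wpoly_exp_monic// size_exp.
by rewrite /wpoly -[1]/(1%:P) size_XnsubC.
Qed.

(** Wallis' integral of (1 - z^2)^l over [-1, 1], in a form free of division. *)
Lemma pint_wpoly_exp l :
  (-1) ^+ l * pint (wpoly ^+ l) * ((2 * l + 1)`!)%:R = 2 * ((2 ^ l * l`!)%:R) ^+ 2.
Proof.
elim: l => [|l IH].
  rewrite !expr0 /pint size_polyC oner_eq0 big_ord1/= coefC eqxx expr1 mul1r.
  rewrite divr1 opprK mul1r !muln1 expr1n. by rewrite (_ : (2 * 0 + 1)`! = 1)%N//.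
set W := fun l => (-1) ^+ l * pint (wpoly ^+ l).
(* Integrating by parts against z and writing z^2 as [wpoly] + 1 gives I_(l+1) = -(2l+2) (I_(l+1) +
   I_l); [W] absorbs the alternating sign. *)
have step : (2 * l + 3)%:R * W l.+1 = (2 * l + 2)%:R * W l.
  have := pint_by_parts 'X (wpoly ^+ l.+1).
  have w0 x : x ^+ 2 = 1 -> (wpoly ^+ l.+1 * 'X).[x] = 0.
    move=> x2; rewrite hornerM horner_exp /wpoly hornerD hornerN hornerXn hornerC.
    by rewrite x2 subrr exprS !mul0r.
  rewrite !w0 ?sqrrN ?expr1n// subrr sub0r derivX mulr1 deriv_exp deriv_wpoly.
  rewrite [_.-1]/=.
  have -> : 'X *+ 2 * wpoly ^+ l *+ l.+1 * 'X =
      (2 * l + 2)%:R *: (wpoly ^+ l.+1 + wpoly ^+ l).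
    by rewrite scaler_nat exprS /wpoly; ring.
  rewrite pintZ pintD => e.
  rewrite /W exprS.
  have -> : (2 * l + 3)%:R * (-1 * (-1) ^+ l * pint (wpoly ^+ l.+1))
     = - (-1) ^+ l * (pint (wpoly ^+ l.+1) + (2 * l + 2)%:R * pint (wpoly ^+ l.+1)).
     by rewrite !natrD; ring.
  rewrite {1}e; ring.
have -> : (2 * l.+1 + 1 = (2 * l + 1).+2)%N by lia.
rewrite !factS -/(W _) !natrM.
have -> : (2 * l + 1).+2 = (2 * l + 3)%N by rewrite -addn2 -addnA.
have -> : (2 * l + 1).+1 = (2 * l + 2)%N by rewrite -addn1 -addnA.
rewrite mulrA (mulrC (W _)) step.
rewrite expnS !natrM exprMn.
have -> : (2 * l + 2)%:R = 2 * l.+1%:R :> R by rewrite -natrM mulnS addnC.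
transitivity ((2 * l.+1%:R) ^+ 2 * (W l * (2 * l + 1)`!%:R)); first by ring.
rewrite /W IH natrM; ring.
Qed.

(** All l+m derivatives are moved onto the other factors, whose product has degree at most l'+m <=
    l+m: the result is 0 if l' < l and a constant if l' = l. The sign (-1)^m turns [wpoly ^+ m] into
    (1 - z^2)^m. *)
Lemma rodrigues_orthogonal l l' m : (m <= l)%N -> (m <= l')%N -> (l' <= l)%N ->
  (-1) ^+ m * pint (wpoly ^+ m * rodrigues R l' m * rodrigues R l m) =
  (l == l')%:R * (((2 ^ l * l`!)%:R) ^+ 2 * (2 / (2 * l + 1)%:R)
                  * ((l + m)`!%:R / (l - m)`!%:R)).
Proof.
move=> ml ml' l'l; rewrite /rodrigues -/wpoly.
set q := wpoly ^+ m * (wpoly ^+ l')^`(_).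
(* Boundary terms: for j < m the factor [wpoly ^+ m] of [q] still vanishes at the endpoints; for j
   >= m fewer than l derivatives remain on [wpoly ^+ l]. *)
have bd x : x ^+ 2 = 1 -> forall j, (j < l + m)%N ->
    (q^`(j) * (wpoly ^+ l)^`(l + m - j.+1)).[x] = 0.
  move=> x2 j jlm; rewrite hornerM; have [jm|mj] := ltnP j m.
    by rewrite  /q horner_derivn_wpoly_exp// mul0r.
  rewrite -(mulr1 (wpoly ^+ l)) (@horner_derivn_wpoly_exp l) ?mulr0//.
  by rewrite ltn_subLR// addSn ltnS addnC leq_add2r.
rewrite pint_by_parts_iter; [|by apply: bd; rewrite expr1n
  |by apply: bd; rewrite sqrrN expr1n].
have sr : (size ((wpoly ^+ l')^`(l' + m))%R <= (l' - m).+1)%N.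
  apply/leq_sizeP => k lk; rewrite coef_derivn nth_default ?mul0rn//.
  by rewrite size_wpoly_exp; move: lk ml'; lia.
have sq : (size q <= (l' + m).+1)%N.
  rewrite (leq_trans (size_polyMleq _ _))// size_wpoly_exp /=.
  by rewrite (leq_trans (leq_add (leqnn _) sr))//; lia.
have [e|nll'] := eqVneq l l'; last first.
  rewrite mul0r; have -> : q^`(l + m) = 0.
    by apply: derivn_poly0; rewrite (leq_trans sq)//; lia.
  by rewrite mul0r pint0 !mulr0.
rewrite -e in q sr sq bd ml' l'l *; rewrite mul1r.
have sq1 : (size (q^`(l + m))%R <= 1)%N.
  apply/leq_sizeP => k lk; rewrite coef_derivn nth_default ?mul0rn//.
  by rewrite (leq_trans sq)//; lia.
(* The (l+m)-th derivative of a polynomial of degree at most l+m is (l+m)! times its coefficient of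
   that degree. As [wpoly ^+ m] is monic, this coefficient is the leading one of the derivative of
   [wpoly ^+ l], namely (2l)!/(l-m)!. *)
have qE : q^`(l + m) = ((2 * l)`!%:R / (l - m)`!%:R * (l + m)`!%:R)%:P.
  rewrite (size1_polyC sq1) coef_derivn addn0 ffactnn; congr (_%:P).
  rewrite -(mulr_natr q`_(l + m)); congr (_ * _).
  have -> : q`_(l + m) = ((wpoly ^+ l)^`(l + m))`_(l - m).
    (* Only the index 2m survives in the convolution: above it the first factor has no coefficient,
       below it the second is past its degree l-m. *)
    rewrite /q coefM (bigD1 (inord (2 * m)))//= inordK; last by move: ml; lia.
    rewrite big1 ?addr0 => [|i ine].
      have := wpoly_exp_monic m; rewrite monicE lead_coefE size_wpoly_exp /=.
      move=> /eqP ->; rewrite mul1r; congr (_`_ _); move: ml; lia.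
    have [im|im] := ltnP (2 * m) i.
      by rewrite nth_default ?mul0r// size_wpoly_exp.
    have {}im : (i < 2 * m)%N.
      rewrite ltn_neqAle im andbT; apply: contra ine => /eqP i2.
      by apply/eqP/val_inj; rewrite /= inordK ?i2//; move: ml; lia.
    rewrite [X in _ * X]nth_default ?mulr0// (leq_trans sr)//; move: im ml; lia.
  rewrite coef_derivn.
  have -> : (l + m + (l - m) = 2 * l)%N by move: ml; lia.
  have := wpoly_exp_monic l; rewrite monicE lead_coefE size_wpoly_exp /=.
  move=> /eqP ->.
  have lm2 : (l + m <= 2 * l)%N by move: ml; lia.
  have := ffact_fact lm2.
  have -> : (2 * l - (l + m) = l - m)%N by move: ml; lia.
  move=> <-; rewrite natrM mulfK// pnatr_eq0 -lt0n fact_gt0 //.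
rewrite qE mul_polyC pintZ exprD.
have -> : (-1) ^+ m * ((-1) ^+ l * (-1) ^+ m * ((2 * l)`!%:R / (l - m)`!%:R
     * (l + m)`!%:R * pint (wpoly ^+ l))) =
   ((-1) ^+ m * (-1) ^+ m) * ((-1) ^+ l * pint (wpoly ^+ l)) *
   ((2 * l)`!%:R / (l - m)`!%:R * (l + m)`!%:R) :> R by ring.
rewrite -expr2 sqrr_sign mul1r.
have := pint_wpoly_exp l; rewrite addn1 factS natrM.
have f1 : ((2 * l)`!%:R : R) != 0 by rewrite pnatr_eq0 -lt0n fact_gt0.
have f2 : ((l - m)`!%:R : R) != 0 by rewrite pnatr_eq0 -lt0n fact_gt0.
have f3 : ((2 * l).+1%:R : R) != 0 by rewrite pnatr_eq0.
move=> h; have -> : (-1) ^+ l * pint (wpoly ^+ l) =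
    2 * (2 ^ l * l`!)%:R ^+ 2 / ((2 * l).+1%:R * (2 * l)`!%:R).
  by rewrite -h mulfK// mulf_neq0.
have gen (a b c g k : R) : a != 0 -> b != 0 -> c != 0 ->
    2 * g ^+ 2 / (c * a) * (a / b * k) = g ^+ 2 * (2 / c) * (k / b).
  by move=> *; field; exact/and3P.
exact: gen.
Qed.

End PolyIntegral.

(** * Rotation invariance of Lebesgue measure *)

(* [\x] of two sigma-finite measures is not inferred to be sigma-finite (the
   instance for finite measures takes precedence), hence these aliases. *)
Section SigmaFiniteProduct.
Context {d1 d2 : measure_display} {T1 : measurableType d1} {T2 : measurableType d2}
  {R : realType}.

Lemma product_sigma_finite (m1 : {sigma_finite_measure set T1 -> \bar R})
    (m2 : {sigma_finite_measure set T2 -> \bar R}) : sigma_finite setT (m1 \x m2)%E.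
Proof.
have /sigma_finiteP[F [TF ndF Foo]] := sigma_finiteT m1.
have /sigma_finiteP[G [TG ndG Goo]] := sigma_finiteT m2.
exists (fun n => F n `*` G n).
  apply/seteqP; split => // -[x y] _.
  have [n _ Fnx] : (\bigcup_i F i) x by rewrite -TF.
  have [k _ Gky] : (\bigcup_i G i) y by rewrite -TG.
  exists (maxn n k) => //; split => /=.
    by move: Fnx; exact/subsetPset/ndF/leq_maxl.
  by move: Gky; exact/subsetPset/ndG/leq_maxr.
move=> k; have [mF Fk] := Foo k; have [mG Gk] := Goo k.
split; first exact: measurableX.
by rewrite product_measure1E// lte_mul_pinfty// ge0_fin_numE.
Qed.

End SigmaFiniteProduct.

Definition leb2 (R : realType) := (@lebesgue_measure R \x @lebesgue_measure R)%E.
HB.instance Definition _ (R : realType) := Measure.on (@leb2 R).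
HB.instance Definition _ (R : realType) := Measure_isSigmaFinite.Build _ _ _
  (@leb2 R) (product_sigma_finite (@lebesgue_measure R) (@lebesgue_measure R)).

Definition leb3_sf (R : realType) := (leb2 R \x @lebesgue_measure R)%E.
HB.instance Definition _ (R : realType) := Measure.on (@leb3_sf R).
HB.instance Definition _ (R : realType) := Measure_isSigmaFinite.Build _ _ _
  (@leb3_sf R) (product_sigma_finite (leb2 R) (@lebesgue_measure R)).

Section Invariance.
Context {R : realType}.
Notation leb := (@lebesgue_measure R).
Implicit Types (f : pt R -> \bar R) (phi : pt R -> pt R).

(** Lebesgue measure is determined by its values on half-open intervals, whose length a translation
    keeps. *)
Lemma lebesgue_measure_translation (a : R) (A : set R) : measurable A ->
  pushforward leb ((fun x => x + a) : _ -> measurableTypeR R) A = leb A.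
Proof.
move=> mA; apply/esym/lebesgue_measure_unique => //=.
  exact: measurable_funD.
move=> mphi X [[c e] _ <-]/=; rewrite /pushforward.
have -> : (fun x : R => x + a) @^-1` `]c, e] = [set` `]c - a, e - a]].
  by apply/seteqP; split => x /=; rewrite !in_itv/= ltrBlDr lerBrDr.
rewrite !lebesgue_measure_itv/= !lte_fin ltrD2r -!EFinB.
by rewrite opprB addrA subrK.
Qed.

Lemma ge0_integral_translation (g : R -> \bar R) (a : R) :
  measurable_fun setT g -> (forall x, 0 <= g x)%E ->
  (\int[leb]_x g (x + a)%R = \int[leb]_x g x)%E.
Proof.
move=> mg g0.
have mphi : measurable_fun setT ((fun x => x + a) : R -> measurableTypeR R).
  exact: measurable_funD.
transitivity (\int[pushforward leb ((fun x => (x + a)%R) : _ -> measurableTypeR R)]_x g x)%E.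
  by rewrite ge0_integral_pushforward.
by apply: eq_measure_integral => //= A mA _; exact: lebesgue_measure_translation.
Qed.

(** Stated through integrals of nonnegative functions, the form that Tonelli's theorem yields and
    that composes without further work. *)
Definition volume_preserving phi := measurable_fun setT phi /\
  forall f, measurable_fun setT f -> (forall p, 0 <= f p)%E ->
    (\int[@leb3 R]_p f (phi p) = \int[@leb3 R]_p f p)%E.

Lemma volume_preserving_comp phi phi' : volume_preserving phi ->
  volume_preserving phi' -> volume_preserving (phi \o phi').
Proof.
move=> [mp hp] [mp' hp']; split; first exact: measurableT_comp.
move=> f mf f0; transitivity (\int[@leb3 R]_p f (phi p))%E; last exact: hp.
by apply: (hp' (f \o phi)) => [|p]; [exact: measurableT_comp|exact: f0].
Qed.

Lemma leb3_fubini f : measurable_fun setT f -> (forall p, 0 <= f p)%E ->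
  (\int[@leb3 R]_p f p = \int[leb]_x \int[leb]_y \int[leb]_z f (x, y, z))%E.
Proof.
move=> mf f0.
have e1 := @fubini_tonelli1 _ _ _ _ _ (leb2 R) leb f mf f0.
have mF := @measurable_fun_fubini_tonelli_F _ _ _ _ _ leb f mf.
have F0 : (forall x, 0 <= fubini_F leb f x)%E by move=> x; exact: integral_ge0.
have e2 := @fubini_tonelli1 _ _ _ _ _ leb leb _ (mF f0) F0.
exact: (etrans e1 e2).
Qed.

Lemma eq_integral_leb3 f g : measurable_fun setT f -> (forall p, 0 <= f p)%E ->
  measurable_fun setT g -> (forall p, 0 <= g p)%E ->
  (\int[leb]_x \int[leb]_y \int[leb]_z f (x, y, z) =
   \int[leb]_x \int[leb]_y \int[leb]_z g (x, y, z))%E ->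
  (\int[@leb3 R]_p f p = \int[@leb3 R]_p g p)%E.
Proof.
move=> mf f0 mg g0 fg.
exact: (etrans (leb3_fubini _ mf f0) (etrans fg (esym (leb3_fubini _ mg g0)))).
Qed.

Lemma measurable_px : measurable_fun setT (@px R).
Proof. exact: (measurableT_comp measurable_fst measurable_fst). Qed.
Lemma measurable_py : measurable_fun setT (@py R).
Proof. exact: (measurableT_comp measurable_snd measurable_fst). Qed.
Lemma measurable_pz : measurable_fun setT (@pz R).
Proof. exact: measurable_snd. Qed.

Definition zshear (a : R) (p : pt R) : pt R := (p.1, pz p + a * py p).
Definition swap_xy (p : pt R) : pt R := (py p, px p, pz p).
Definition swap_yz (p : pt R) : pt R := (px p, pz p, py p).

(** For fixed x and y the shear translates z by a y, which leaves the innermost integral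
    unchanged. *)
Lemma zshear_preserving a : volume_preserving (zshear a).
Proof.
have m : measurable_fun setT (zshear a).
  apply/measurable_fun_pair; first exact: measurable_fst.
  apply: measurable_funD; first exact: measurable_pz.
  by apply: measurable_funM => //; exact: measurable_py.
split=> // f mf f0; have mf' := measurableT_comp mf m.
refine (eq_integral_leb3 (f \o zshear a) f mf' (fun p => f0 _) mf f0 _).
apply: eq_integral => x _; apply: eq_integral => y _.
apply: (ge0_integral_translation (fun z => f (x, y, z)) (a * y)) => //.
exact: (measurableT_comp mf (pair1_measurable (x, y))).
Qed.

Lemma swap_yz_preserving : volume_preserving swap_yz.
Proof.
have m : measurable_fun setT swap_yz.
  apply/measurable_fun_pair; last exact: measurable_py.
  apply/measurable_fun_pair; [exact: measurable_px|exact: measurable_pz].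
split=> // f mf f0; have mf' := measurableT_comp mf m.
refine (eq_integral_leb3 (f \o swap_yz) f mf' (fun p => f0 _) mf f0 _).
apply: eq_integral => x _.
refine (@fubini_tonelli _ _ _ _ _ leb leb (fun yz => f (x, yz.2, yz.1)) _ _) => //.
apply: (measurableT_comp mf); apply/measurable_fun_pair; last exact: measurable_fst.
by apply/measurable_fun_pair => //; exact: measurable_snd.
Qed.

(** The two outer integrations are exchanged, so Tonelli's theorem is applied to the inner integral
    over z as a function of (x, y). *)
Lemma swap_xy_preserving : volume_preserving swap_xy.
Proof.
have m : measurable_fun setT swap_xy.
  apply/measurable_fun_pair; last exact: measurable_pz.
  apply/measurable_fun_pair; [exact: measurable_py|exact: measurable_px].
split=> // f mf f0; have mf' := measurableT_comp mf m.
refine (eq_integral_leb3 (f \o swap_xy) f mf' (fun p => f0 _) mf f0 _).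
refine (@fubini_tonelli _ _ _ _ _ leb leb
  (fun xy => \int[leb]_z f (xy.2, xy.1, z))%E _ _) => /=; last first.
  by move=> x; exact: integral_ge0.
apply: (@measurable_fun_fubini_tonelli_F _ _ _ _ _ leb
  (fun q : (R * R) * R => f (q.1.2, q.1.1, q.2))) => //.
Qed.

Definition rot_yz (c s : R) (p : pt R) : pt R :=
  (px p, c * py p - s * pz p, s * py p + c * pz p).
Definition rot_xy (c s : R) (p : pt R) : pt R :=
  (c * px p - s * py p, s * px p + c * py p, pz p).

(* A rotation is a product of three shears. *)
Lemma rot_yz_preserving c s : c ^+ 2 + s ^+ 2 = 1 -> s != 0 ->
  volume_preserving (rot_yz c s).
Proof.
(* [a] is the tangent of half the angle; [ac] below is its second expression s / (1 + c). *)
move=> cs s0; pose a := (1 - c) / s.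
(* Conjugated by the swap, the middle shear acts on y, as y - s z. *)
have -> : rot_yz c s = zshear a \o
    (swap_yz \o (zshear (- s) \o (swap_yz \o zshear a))).
  apply/funext => -[[x y] z]; rewrite /rot_yz /zshear /swap_yz /px /py /pz /=.
  have as_ : a * s = 1 - c by rewrite /a divfK.
  have ac : a * (1 + c) = s.
    apply: (mulIf s0); rewrite mulrAC as_ -expr2 -[s ^+ 2](addKr (c ^+ 2)) cs.
    by ring.
  congr (_, _, _).
    have -> : y + - s * (z + a * y) = y * (1 - a * s) - s * z by ring.
    by rewrite as_; ring.
  have -> : z + a * y + a * (y + - s * (z + a * y)) =
    z * (1 - a * s) + a * (1 + (1 - a * s)) * y by ring.
  by rewrite as_ (_ : 1 - (1 - c) = c) ?ac; ring.
have h1 := zshear_preserving; have h2 := swap_yz_preserving.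
by do ?apply: volume_preserving_comp => //.
Qed.

(** A cyclic permutation of the coordinates conjugates this rotation to [rot_yz]. *)
Lemma rot_xy_preserving c s : c ^+ 2 + s ^+ 2 = 1 -> s != 0 ->
  volume_preserving (rot_xy c s).
Proof.
move=> cs s0.
have -> : rot_xy c s = swap_yz \o (swap_xy \o (rot_yz c s \o (swap_xy \o swap_yz))).
  by apply/funext => -[[x y] z].
have h1 := swap_xy_preserving; have h2 := swap_yz_preserving.
have h3 := rot_yz_preserving _ _ cs s0.
by do ?apply: volume_preserving_comp => //.
Qed.

End Invariance.

(** * Volume of the ball *)

Section Volume.
Context {R : realType}.
Notation leb := (@lebesgue_measure R).

Lemma measurable_fun_sqrt : measurable_fun setT (@Num.sqrt R).
Proof. by apply: continuous_measurable_fun; exact: sqrt_continuous. Qed.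

Lemma integral_semicircle (r : R) : 0 < r ->
  (\int[leb]_(y in `[(- r)%R, r]) (2 * Num.sqrt (r ^+ 2 - y ^+ 2))%:E
    = (pi * r ^+ 2)%:E)%E.
Proof.
move=> r0.
(* The classical antiderivative of 2 sqrt(r^2 - y^2). It is differentiated only on the open
   interval, since [asin] is not derivable at the endpoints; there continuity has to suffice. *)
pose F (y : R) : R := y * Num.sqrt (r ^+ 2 - y ^+ 2) + r ^+ 2 * asin (y / r).
have rE : r != 0 by rewrite gt_eqF.
have c1 : continuous (fun y : R => Num.sqrt (r ^+ 2 - y ^+ 2)).
  move=> y; apply: (@continuous_comp _ _ _ (fun y : R => r ^+ 2 - y ^+ 2) Num.sqrt).
    apply: cvgB; first exact: cvg_cst.
    exact: exprn_continuous.
  exact: sqrt_continuous.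
(* Continuity up to the endpoints comes from inverting the continuous function r sin t on
   [-pi/2, pi/2]. *)
have c2 : {within `[(- r), r], continuous (fun y : R => asin (y / r))}.
  have := @segment_can_le_continuous R (- (pi / 2)) (pi / 2)
    (fun t : R => r * sin t) (fun y : R => asin (y / r)).
  rewrite sinN sin_pihalf mulrN1 mulr1; apply.
  - by rewrite -subr_ge0 opprK -splitr pi_ge0.
  - apply: continuous_subspaceT => t.
    by apply: cvgM; [exact: cvg_cst|exact: continuous_sin].
  - by move=> t tpi; rewrite mulrAC divff// mul1r sinK.
have cF : {within `[(- r), r], continuous F}.
  move=> y; apply: cvgD; last by apply: cvgM; [exact: cvg_cst|exact: c2].
  have : {within `[(- r), r], continuous (fun y : R => y * Num.sqrt (r ^+ 2 - y ^+ 2))}.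
    by apply: continuous_subspaceT => z; apply: cvgM; [exact: cvg_id|exact: c1].
  exact.
have dF (y : R) : y \in `](- r), r[ -> is_derive y 1 F (2 * Num.sqrt (r ^+ 2 - y ^+ 2)).
  rewrite in_itv/= => /andP[ry yr].
  have s0 : 0 < r ^+ 2 - y ^+ 2.
    by rewrite subr_gt0 -[y ^+ 2]real_normK ?num_real// ltrXn2r// ltr_norml ry.
  have d1 : is_derive y 1 (fun y : R => r ^+ 2 - y ^+ 2) (- (2 * y)).
    by apply: is_derive_eq; rewrite -[_%:A]/(y * 1); ring.
  have d2 := is_derive1_sqrt s0.
  have d3 := @is_derive1_comp _ Num.sqrt (fun y : R => r ^+ 2 - y ^+ 2) y _ _ d2 d1.
  have y1 : -1 < y / r < 1.
    by rewrite ltr_pdivlMr// mulN1r ry ltr_pdivrMr// mul1r.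
  have d4 := is_derive1_asin y1.
  have d5 : is_derive y 1 (fun y : R => y / r) r^-1.
    by apply: is_derive_eq; rewrite scaler0 add0r -[_%:A]/(r^-1 * 1) mulr1.
  have d6 := @is_derive1_comp _ (@asin R) (fun y : R => y / r) y _ _ d4 d5.
  have sE : Num.sqrt (1 - (y / r) ^+ 2) = Num.sqrt (r ^+ 2 - y ^+ 2) / r.
    have -> : 1 - (y / r) ^+ 2 = (r ^+ 2 - y ^+ 2) * (r^-1) ^+ 2 by field.
    by rewrite sqrtrM ?ltW// sqrtr_sqr ger0_norm// invr_ge0 ltW.
  have dy : is_derive y 1 (@idfun R) 1 by exact: is_derive_id.
  have d7 := is_deriveM dy d3.
  have d8 := is_deriveZ (r ^+ 2) d6.
  apply: (is_derive_eq (is_deriveD d7 d8)).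
  rewrite sE /GRing.scale/=.
  have := sqr_sqrtr (ltW s0); set S := Num.sqrt _ => hS.
  have S0 : S != 0 by rewrite gt_eqF// sqrtr_gt0.
  have -> : y * ((2 * S)^-1 * - (2 * y)) + S * 1 + r ^+ 2 * ((S / r)^-1 / r) =
    (r ^+ 2 - y ^+ 2) / S + S by field; rewrite S0.
  by rewrite -hS; field.
rewrite (@continuous_FTC2 _ _ F).
- rewrite /F sqrrN subrr sqrtr0 !mulr0 !add0r divff// mulNr divff//.
  have pi2 : - (pi / 2) <= pi / 2 :> R by rewrite -subr_ge0 opprK -splitr pi_ge0.
  have a1 : asin (1 : R) = pi / 2.
    by have := @sinK R (pi / 2); rewrite sin_pihalf; apply; rewrite in_itv/= lexx pi2.
  have aN1 : asin (-1 : R) = - (pi / 2).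
    have := @sinK R (- (pi / 2)); rewrite sinN sin_pihalf; apply.
    by rewrite in_itv/= lexx pi2.
  by rewrite a1 aN1 -EFinB; congr EFin; field.
- by rewrite -subr_gt0 opprK addr_gt0.
- apply: continuous_subspaceT => z.
  by apply: cvgM; [exact: cvg_cst|exact: c1].
- have rr : - r < r by rewrite -subr_gt0 opprK addr_gt0.
  have [_ cl cr] := (continuous_within_itvP F rr).1 cF.
  by split => // y yr; have [] := dF _ yr.
- by move=> y yr; rewrite derive1E; have [_ ->] := dF _ yr.
Qed.

(** Area of a disc of radius sqrt(c). The square root of a negative number is 0, so the integral
    runs over the whole line and an empty disc gives 0. *)
Lemma integral_sqrt_disc (c : R) :
  (\int[leb]_y (2 * Num.sqrt (c - y ^+ 2))%:E = (pi * Num.max c 0)%:E)%E.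
Proof.
have [c0|c0] := leP c 0.
  rewrite mulr0; apply: integral0_eq => y _.
  by rewrite ler0_sqrtr ?mulr0// subr_le0 (le_trans c0)// sqr_ge0.
have s0 : 0 < Num.sqrt c by rewrite sqrtr_gt0.
have := integral_semicircle _ s0; rewrite sqr_sqrtr ?ltW// => <-.
rewrite [RHS]integral_mkcond; apply: eq_integral => y _.
rewrite patchE mem_setE in_itv/= -ler_norml; case: ifPn => // ny.
have {}ny : Num.sqrt c <= `|y| by rewrite ltW// ltNge.
rewrite ler0_sqrtr ?mulr0// subr_le0 -(sqr_sqrtr (ltW c0)).
by rewrite -(real_normK (num_real y)) lerXn2r ?nnegrE ?sqrtr_ge0.
Qed.

(** Cavalieri: the slice of the unit ball at abscissa x is a disc of squared radius 1 - x^2, or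
    empty. *)
Lemma integral_disc_slices :
  (\int[leb]_x (pi * Num.max (1 - x ^+ 2) 0)%:E = (4 / 3 * pi)%:E :> \bar R)%E.
Proof.
transitivity (\int[leb]_(x in `[(-1)%R, 1%R]) (pi * (1 - x ^+ 2))%:E)%E.
  rewrite [RHS]integral_mkcond; apply: eq_integral => x _.
  rewrite patchE mem_setE in_itv/= -ler_norml; case: ifPn => nx.
    rewrite max_l// subr_ge0 -[x ^+ 2]real_normK ?num_real//.
    by rewrite exprn_ile1.
  rewrite max_r ?mulr0// subr_le0 -[x ^+ 2]real_normK ?num_real//.
  by rewrite exprn_ege1// ltW// ltNge.
pose F (x : R) : R := pi * (x - x ^+ 3 / 3).
have dF (x : R) : is_derive x 1 F (pi * (1 - x ^+ 2)).
  apply: is_derive_eq.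
  by rewrite /GRing.scale/=; field.
rewrite (@continuous_FTC2 _ _ F).
- by rewrite /F -EFinB; congr EFin; field.
- by rewrite -subr_gt0 opprK.
- apply: continuous_subspaceT => z.
  by apply: cvgM; [exact: cvg_cst|apply: cvgB; [exact: cvg_cst|exact: exprn_continuous]].
- have cF : continuous F.
    by move=> y; apply: differentiable_continuous; apply/derivable1_diffP; have [] := dF y.
  split; first by move=> y _; have [] := dF y.
    exact: cvg_at_right_filter (cF _).
  exact: cvg_at_left_filter (cF _).
- by move=> y yr; rewrite derive1E; have [_ ->] := dF y.
Qed.
End Volume.

(** * Geometry of the sphere and of the ball *)

Section SphereGeometry.
Context {R : realType}.
Notation leb := (@lebesgue_measure R).
Implicit Types (p : pt R).

Definition sqnorm p : R := px p ^+ 2 + py p ^+ 2 + pz p ^+ 2.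

Lemma sqnorm_ge0 p : 0 <= sqnorm p.
Proof. by rewrite !addr_ge0 ?sqr_ge0. Qed.

Lemma sqr_pnorm p : pnorm p ^+ 2 = sqnorm p.
Proof. by rewrite sqr_sqrtr ?sqnorm_ge0. Qed.

Lemma pnorm_ge0 p : 0 <= pnorm p.
Proof. exact: sqrtr_ge0. Qed.

Lemma measurable_sqnorm : measurable_fun setT sqnorm.
Proof.
apply: measurable_funD; last exact: measurable_funX measurable_pz.
apply: measurable_funD; first exact: measurable_funX measurable_px.
exact: measurable_funX measurable_py.
Qed.

Lemma measurable_pnorm : measurable_fun setT (@pnorm R).
Proof. exact: (measurableT_comp measurable_fun_sqrt measurable_sqnorm). Qed.

Lemma measurable_sphere : measurable (@sphere R).
Proof.
rewrite -[X in measurable X]setTI.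
exact: (measurable_pnorm measurableT [set 1] (measurable_set1 1)).
Qed.

Lemma measurable_ball3 : measurable (@ball3 R).
Proof.
have -> : @ball3 R = setT `&` @pnorm R @^-1` `]0, 1].
  by rewrite setTI; apply/seteqP; split => p; rewrite /ball3/= in_itv.
exact: (measurable_pnorm measurableT _ (measurable_itv _)).
Qed.

(** The ball with its centre put back, so that membership is a single polynomial inequality and
    every slice is an interval. *)
Definition cball : set (pt R) := [set p | sqnorm p <= 1].

Lemma measurable_cball : measurable cball.
Proof.
have -> : cball = setT `&` sqnorm @^-1` `]-oo, 1].
  by rewrite setTI; apply/seteqP; split => p; rewrite /cball/= in_itv.
exact: (measurable_sqnorm measurableT _ (measurable_itv _)).
Qed.

Lemma sqnorm_eq0 p : (sqnorm p == 0) = (p == (0, 0, 0)).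
Proof.
case: p => [[x y] z]; rewrite /sqnorm /px /py /pz /=.
rewrite !paddr_eq0 ?addr_ge0 ?sqr_ge0// !sqrf_eq0.
by apply/idP/eqP => [/andP[/andP[/eqP -> /eqP ->] /eqP ->]|[-> -> ->]]; rewrite ?eqxx.
Qed.

Lemma cballE : cball = @ball3 R `|` [set (0, 0, 0)].
Proof.
apply/seteqP; split => p; rewrite /cball /ball3 /=.
  move=> p1; have [->|p0] := eqVneq p (0, 0, 0); [by right|left].
  rewrite lt_neqAle pnorm_ge0 andbT eq_sym sqrtr_eq0 -/(sqnorm p) -ltNge.
  rewrite lt_neqAle eq_sym sqnorm_eq0 p0 sqnorm_ge0/=.
  by rewrite -(@expr_le1 _ 2) ?pnorm_ge0// sqr_pnorm.
case=> [/andP[_ p1]|->]; last first.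
  by rewrite /sqnorm /px/py/pz/= expr0n/= !addr0 ler01.
by rewrite -sqr_pnorm expr_le1 ?pnorm_ge0.
Qed.

Lemma leb3_cball : @leb3 R cball = (4 / 3 * pi)%:E.
Proof.
have e : (\int[@leb3 R]_p (\1_cball p)%:E = @leb3 R cball)%E.
  by refine (etrans (integral_indic _ _ _) _) => //; [exact: measurable_cball|rewrite setIT].
rewrite -e -integral_disc_slices.
have mI : measurable_fun setT (fun p : pt R => (\1_cball p : R)%:E).
  by apply/measurable_EFinP; apply: measurable_indic; apply: measurable_cball.
refine (etrans (leb3_fubini _ mI _) _) => [p|]; first by rewrite /= lee_fin.
apply: eq_integral => x _; rewrite -integral_sqrt_disc.
apply: eq_integral => y _ /=.
(* Outside the unit disc the slice is empty, in agreement with the square root being 0 there. *)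
have [h|h] := leP (x ^+ 2 + y ^+ 2) 1; last first.
  rewrite ler0_sqrtr ?mulr0; last by rewrite -addrA -opprD subr_le0 ltW.
  apply: integral0_eq => z _; rewrite indicE memNset// /cball /sqnorm/=.
  apply/negP; rewrite -ltNge (lt_le_trans h)//.
  by rewrite /px/py/pz/= lerDl sqr_ge0.
set s := Num.sqrt _.
transitivity (\int[leb]_z (\1_(`[- s, s]%classic) z)%:E)%E.
  apply: eq_integral => z _; congr (_%:E); rewrite !indicE; congr (nat_of_bool _)%:R.
  apply/idP/idP; rewrite !inE /cball /sqnorm /px /py /pz/= in_itv/= -ler_norml => hz.
    rewrite -(@ler_pXn2r _ 2) ?nnegrE ?sqrtr_ge0// real_normK ?num_real//.
    by rewrite sqr_sqrtr; lra.
  move: hz; rewrite -(@ler_pXn2r _ 2) ?nnegrE ?sqrtr_ge0// real_normK ?num_real//.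
  by rewrite sqr_sqrtr; lra.
rewrite integral_indic// setIT; rewrite [LHS]lebesgue_measure_itv/= lte_fin.
case: ltP => [_|ss]; first by rewrite -EFinD; congr EFin; ring.
have s0 : 0 <= s by exact: sqrtr_ge0.
by congr EFin; lra.
Qed.

(** The centre, by which the two balls differ, is a product of points and hence a null set. *)
Lemma leb3_ball3 : @leb3 R (@ball3 R) = (4 / 3 * pi)%:E.
Proof.
have s0 : [set ((0, 0, 0) : pt R)] = (([set 0] `*` [set 0]) `*` [set 0] : set (pt R)).
  by apply/seteqP; split => [p ->//|[[x y] z] /= [[-> ->] ->]].
have ms0 : measurable [set ((0, 0, 0) : pt R)].
  by rewrite s0; apply: measurableX => //; exact: measurableX.
have m0 : @leb3 R [set (0, 0, 0)] = 0%E.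
  rewrite s0; refine (etrans (@product_measure1E _ _ _ _ _ (leb2 R) leb _ _ _ _) _) => //.
    exact: measurableX.
  by rewrite [X in (_ * X)%E]lebesgue_measure_set1 mule0.
rewrite -leb3_cball cballE.
have d0 : @ball3 R `&` [set (0, 0, 0)] = set0.
  apply/seteqP; split => // p /= [+ p0]; rewrite p0 /ball3/= => /andP[+ _].
  by rewrite lt_neqAle eq_sym sqrtr_eq0 /px/py/pz/= expr0n/= !addr0 lexx.
have h := @measureU _ _ _ (@leb3 R) _ _ measurable_ball3 ms0 d0.
exact: (esym (etrans h (etrans (congr1 (fun x => _ + x)%E m0) (adde0 _)))).
Qed.

End SphereGeometry.

(** * The integral of x/|x| over the ball *)

Section SphereMean.
Context {R : realType}.
Notation leb := (@lebesgue_measure R).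
Implicit Types (p : pt R) (f g : pt R -> R).

Lemma measurable_normalize : measurable_fun setT (@normalize R).
Proof.
have mV : measurable_fun setT (fun p : pt R => (pnorm p)^-1).
  (* On nonnegative reals, 0 included, the inverse agrees with the real power of exponent -1, which
     is measurable everywhere. *)
  rewrite (_ : (fun p => _) = (fun x => x `^ (-1)) \o @pnorm R); last first.
    by apply/funext => p /=; rewrite powR_inv1// pnorm_ge0.
  exact: (measurableT_comp (measurable_powR (-1)) measurable_pnorm).
apply/measurable_fun_pair; last exact: (measurable_funM measurable_pz mV).
apply/measurable_fun_pair; first exact: (measurable_funM measurable_px mV).
exact: (measurable_funM measurable_py mV).
Qed.

Lemma sphereP p : sphere p <-> sqnorm p = 1.
Proof.
rewrite /sphere/= -sqr_pnorm; split=> [->|/eqP]; first by rewrite expr1n.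
by rewrite sqrp_eq1 ?pnorm_ge0// => /eqP.
Qed.

Lemma normalize_sphere p : ball3 p -> sphere (normalize p).
Proof.
move=> /andP[p0 _]; apply/sphereP.
rewrite /sqnorm /normalize /px /py /pz /= !expr_div_n -!mulrDl -/(sqnorm p).
by rewrite -sqr_pnorm divff// expf_neq0// gt_eqF.
Qed.

(** The bound is required on the sphere only: just the values at normalized points are integrated,
    and coordinates are unbounded in space. *)
Definition bounded_measurable f := measurable_fun setT f /\
  exists M, forall p, sphere p -> `|f p| <= M.
Local Notation bm := bounded_measurable.

Lemma bm_cst (a : R) : bm (fun=> a).
Proof. by split; [exact: measurable_cst|exists `|a|]. Qed.

Lemma bmD f g : bm f -> bm g -> bm (fun p => f p + g p).
Proof.
move=> [mf [M fM]] [mg [N gN]]; split; first exact: measurable_funD.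
exists (M + N) => p Sp; rewrite (le_trans (ler_normD _ _))// lerD//; auto.
Qed.

Lemma bmM f g : bm f -> bm g -> bm (fun p => f p * g p).
Proof.
move=> [mf [M fM]] [mg [N gN]]; split; first exact: measurable_funM.
by exists (M * N) => p Sp; rewrite normrM ler_pM//; auto.
Qed.

Lemma bmN f : bm f -> bm (fun p => - f p).
Proof.
move=> bf; rewrite (_ : (fun p => - f p) = (fun p => -1 * f p)).
  exact: bmM (bm_cst _) bf.
by apply/funext => p; rewrite mulN1r.
Qed.

Lemma bmX f n : bm f -> bm (fun p => f p ^+ n).
Proof.
move=> bf; elim: n => [|n IH]; first exact: bm_cst.
by under eq_fun do rewrite exprS; exact: bmM.
Qed.

Lemma bm_sum (I : Type) (r : seq I) (F : I -> pt R -> R) :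
  (forall i, bm (F i)) -> bm (fun p => \sum_(i <- r) F i p).
Proof.
move=> bF; elim: r => [|i r IH].
  by under eq_fun do rewrite big_nil; exact: bm_cst.
by under eq_fun do rewrite big_cons; exact: bmD.
Qed.

Lemma bm_px : bm (@px R).
Proof.
split; [exact: measurable_px|exists 1 => p /sphereP p1].
rewrite -(@expr_le1 _ 2)// real_normK ?num_real// -p1 /sqnorm -addrA.
by rewrite lerDl addr_ge0 ?sqr_ge0.
Qed.

Lemma bm_py : bm (@py R).
Proof.
split; [exact: measurable_py|exists 1 => p /sphereP p1].
rewrite -(@expr_le1 _ 2)// real_normK ?num_real// -p1 /sqnorm addrAC.
by rewrite lerDr addr_ge0 ?sqr_ge0.
Qed.

Lemma bm_pz : bm (@pz R).
Proof.
split; [exact: measurable_pz|exists 1 => p /sphereP p1].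
rewrite -(@expr_le1 _ 2)// real_normK ?num_real// -p1 /sqnorm.
by rewrite lerDr addr_ge0 ?sqr_ge0.
Qed.

Lemma bm_integrable f : bm f ->
  (@leb3 R).-integrable (@ball3 R) (fun p => (f (normalize p))%:E).
Proof.
move=> [mf [M fM]].
refine (@measurable_bounded_integrable _ _ _ (@leb3 R) (f \o @normalize R)
  (@ball3 R) measurable_ball3 _ _ _).
- have fin : (@leb3 R (@ball3 R) < +oo)%E by rewrite leb3_ball3 ltry.
  exact: fin.
- apply: (measurable_funS measurableT (@subsetT _ _)).
  exact: (measurableT_comp mf measurable_normalize).
- exists M; split; first exact: num_real.
  move=> x Mx p /normalize_sphere Sp /=.
  exact: le_trans (fM _ Sp) (ltW Mx).
Qed.

(* One third of the integral over the sphere. *)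
Definition ball_integral f : R :=
  fine (\int[@leb3 R]_(p in @ball3 R) (f (normalize p))%:E)%E.
Local Notation psi := ball_integral.

Lemma ball_integralE f : bm f ->
  (\int[@leb3 R]_(p in @ball3 R) (f (normalize p))%:E)%E = (psi f)%:E.
Proof.
move=> bf; apply/esym/fineK.
refine (integrable_fin_num _ (bm_integrable _ bf)); exact: measurable_ball3.
Qed.

Lemma eq_ball_integral f g : (forall p, sphere p -> f p = g p) -> psi f = psi g.
Proof.
move=> fg; congr fine; apply: eq_integral => p.
by rewrite inE => /normalize_sphere/fg ->.
Qed.

Lemma ball_integralD f g : bm f -> bm g ->
  psi (fun p => f p + g p) = psi f + psi g.
Proof.
move=> bf bg; apply: EFin_inj.
refine (etrans (esym (ball_integralE _ (bmD _ _ bf bg))) _).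
refine (etrans (@integralD _ _ _ (@leb3 R) _ measurable_ball3 _ _ (bm_integrable _ bf)
  (bm_integrable _ bg)) _).
exact: (f_equal2 adde (ball_integralE _ bf) (ball_integralE _ bg)).
Qed.

Lemma ball_integralZ (a : R) f : bm f -> psi (fun p => a * f p) = a * psi f.
Proof.
move=> bf; apply: EFin_inj.
refine (etrans (esym (ball_integralE _ (bmM _ _ (bm_cst a) bf))) _).
refine (etrans (@integralZl _ _ _ (@leb3 R) _ measurable_ball3 _ (bm_integrable _ bf) a) _).
exact: (f_equal (mule a%:E) (ball_integralE _ bf)).
Qed.

Lemma ball_integralN f : bm f -> psi (fun p => - f p) = - psi f.
Proof.
move=> bf; rewrite -mulN1r -ball_integralZ//.
by apply: eq_ball_integral => p _; rewrite mulN1r.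
Qed.

Lemma ball_integral_cst (a : R) : psi (fun=> a) = a * (4 / 3 * pi).
Proof.
rewrite (_ : (fun=> a) = (fun=> a * 1)); last by apply/funext => p; rewrite mulr1.
rewrite (ball_integralZ a (fun=> 1) (bm_cst 1)); congr (_ * _).
apply: EFin_inj; refine (etrans (esym (ball_integralE _ (bm_cst 1))) _).
refine (etrans (@integral_cst _ _ _ (@leb3 R) _ measurable_ball3 1) _).
exact: (etrans (mul1e _) leb3_ball3).
Qed.

Lemma ball_integral_sum (I : Type) (r : seq I) (F : I -> pt R -> R) :
  (forall i, bm (F i)) ->
  psi (fun p => \sum_(i <- r) F i p) = \sum_(i <- r) psi (F i).
Proof.
move=> bF; elim: r => [|i r IH].
  rewrite big_nil -[RHS](mul0r (4 / 3 * pi)) -ball_integral_cst.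
  by apply: eq_ball_integral => p _; rewrite big_nil.
rewrite big_cons -IH -ball_integralD//; last exact: bm_sum.
by apply: eq_ball_integral => p _; rewrite big_cons.
Qed.

Section Isometry.
Variable phi : pt R -> pt R.
Hypothesis phi_vol : volume_preserving phi.
Hypothesis phi_norm : forall p, pnorm (phi p) = pnorm p.
Hypothesis phi_normalize : forall p, normalize (phi p) = phi (normalize p).

(** Extended by 0 outside the ball, the integrand is a function on the whole space. Composition with
    [phi] respects both the cut-off, as norms are kept, and the normalization. *)
Lemma ge0_integral_ball3_isometry (g : pt R -> \bar R) :
  measurable_fun setT g -> (forall p, 0 <= g p)%E ->
  (\int[@leb3 R]_(p in @ball3 R) g (phi (normalize p)) =
   \int[@leb3 R]_(p in @ball3 R) g (normalize p))%E.
Proof.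
move=> mg g0; pose h := (fun p => g (normalize p)) \_ (@ball3 R).
have mh : measurable_fun setT h.
  apply/(measurable_restrictT _ measurable_ball3).
  apply: (measurable_funS measurableT (@subsetT _ _)).
  exact: (measurableT_comp mg measurable_normalize).
have h0 p : (0 <= h p)%E by rewrite /h patchE; case: ifP.
refine (etrans (integral_mkcond _ _) (etrans _ (esym (integral_mkcond _ _)))).
refine (etrans _ (phi_vol.2 h mh h0)).
apply: eq_integral => p _; rewrite /h !patchE phi_normalize.
have -> : (phi p \in @ball3 R) = (p \in @ball3 R).
  by apply/idP/idP; rewrite !inE /ball3/= phi_norm.
by [].
Qed.

Lemma ball_integral_isometry f : measurable_fun setT f -> psi (f \o phi) = psi f.
Proof.
move=> mf; congr fine; have mfE : measurable_fun setT (EFin \o f) by exact/measurable_EFinP.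
refine (etrans (integralE _ _ _) (etrans _ (esym (integralE _ _ _)))).
(* [h] will be the positive and the negative part; treated separately, they ask for no integrability
   of [f]. *)
have cut (h : \bar R -> \bar R) : (forall x, 0 <= h x)%E -> measurable_fun setT h ->
    (\int[@leb3 R]_(p in @ball3 R) h (f (phi (normalize p)))%:E =
     \int[@leb3 R]_(p in @ball3 R) h (f (normalize p))%:E)%E.
  move=> h0 mh; refine (ge0_integral_ball3_isometry (fun q => h (f q)%:E) _ _) => //.
  exact: (measurableT_comp mh mfE).
have p0 x : (0 <= maxe x 0 :> \bar R)%E by rewrite le_max lexx orbT.
have n0 x : (0 <= maxe (- x) 0 :> \bar R)%E by rewrite le_max lexx orbT.
have mp : measurable_fun setT (fun x : \bar R => maxe x 0%E).
  by apply: measurable_maxe.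
have mn : measurable_fun setT (fun x : \bar R => maxe (- x)%E 0%E).
  by apply: measurable_maxe => //; exact: measurable_oppe.
have posE (F : pt R -> \bar R) : (F^\+)%E = fun p => maxe (F p) 0%E.
  by apply/funext => p; rewrite funeposE.
have negE (F : pt R -> \bar R) : (F^\-)%E = fun p => maxe (- F p)%E 0%E.
  by apply/funext => p; rewrite funenegE.
refine (f_equal2 (fun x y => x - y)%E _ _).
  rewrite !posE; exact: cut _ p0 mp.
rewrite !negE; exact: cut _ n0 mn.
Qed.

End Isometry.

Lemma ball_integral_swap_xy f : measurable_fun setT f -> psi (f \o swap_xy) = psi f.
Proof.
have nE p : pnorm (swap_xy p) = pnorm p.
  by case: p => [[x y] z]; rewrite /pnorm /swap_xy /px /py /pz /= (addrC (x ^+ 2)).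
apply: ball_integral_isometry => // [|p]; first exact: swap_xy_preserving.
by rewrite /normalize nE.
Qed.

Lemma ball_integral_rot_yz (c s : R) f : c ^+ 2 + s ^+ 2 = 1 -> s != 0 ->
  measurable_fun setT f -> psi (f \o rot_yz c s) = psi f.
Proof.
move=> cs s0; have nE p : pnorm (rot_yz c s p) = pnorm p.
  case: p => [[x y] z]; rewrite /pnorm /rot_yz /px /py /pz /=; congr Num.sqrt.
  transitivity (x ^+ 2 + (c ^+ 2 + s ^+ 2) * (y ^+ 2 + z ^+ 2)); first by ring.
  by rewrite cs; ring.
apply: ball_integral_isometry => // [|p]; first exact: rot_yz_preserving.
rewrite /normalize nE /rot_yz /px /py /pz /=.
by congr (_, _, _); ring.
Qed.

Lemma ball_integral_rot_xy (c s : R) f : c ^+ 2 + s ^+ 2 = 1 -> s != 0 ->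
  measurable_fun setT f -> psi (f \o rot_xy c s) = psi f.
Proof.
move=> cs s0; have nE p : pnorm (rot_xy c s p) = pnorm p.
  case: p => [[x y] z]; rewrite /pnorm /rot_xy /px /py /pz /=; congr Num.sqrt.
  transitivity ((c ^+ 2 + s ^+ 2) * (x ^+ 2 + y ^+ 2) + z ^+ 2); first by ring.
  by rewrite cs; ring.
apply: ball_integral_isometry => // [|p]; first exact: rot_xy_preserving.
rewrite /normalize nE /rot_xy /px /py /pz /=.
by congr (_, _, _); ring.
Qed.

End SphereMean.
Local Notation bm := bounded_measurable.
Local Notation psi := ball_integral.

(** * Moments of the height function *)

Section Moments.
Context {R : realType}.
Implicit Types (f : pt R -> R).

Definition moment (n : nat) : R := psi (fun p => pz p ^+ n).

Lemma moment_rot (c s : R) n : c ^+ 2 + s ^+ 2 = 1 -> s != 0 ->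
  psi (fun p => (c * pz p + s * py p) ^+ n) = moment n.
Proof.
move=> cs s0; have m := (bmX _ n (@bm_pz R)).1.
rewrite /moment -(ball_integral_rot_yz c s (fun p => pz p ^+ n) cs s0 m).
apply: eq_ball_integral => -[[x y] z] _; rewrite /rot_yz /pz /py /=.
by rewrite addrC.
Qed.

(** Quarter turns in the two senses take z to y and to -y. The half turn, which would take z to -z
    at once, has sine 0. *)
Lemma moment_odd n : odd n -> moment n = 0.
Proof.
move=> on.
have e1 : psi (fun p => py p ^+ n) = moment n.
  have u : 0 ^+ 2 + 1 ^+ 2 = 1 :> R by ring.
  rewrite -(moment_rot _ _ n u (oner_neq0 _)).
  by apply: eq_ball_integral => p _; rewrite mul0r add0r mul1r.
have e2 : psi (fun p => - py p ^+ n) = moment n.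
  have u : 0 ^+ 2 + (-1) ^+ 2 = 1 :> R by ring.
  have v : -1 != 0 :> R by rewrite oppr_eq0 oner_eq0.
  rewrite -(moment_rot _ _ n u v).
  apply: eq_ball_integral => p _.
  by rewrite mul0r add0r mulN1r exprNn -signr_odd on expr1 mulN1r.
have := e2; rewrite ball_integralN ?e1; last exact: bmX bm_py.
by move=> e; lra.
Qed.

Lemma coef2_1X2_exp k : ((1 + 'X ^+ 2) ^+ k : {poly R})`_2 = k%:R.
Proof.
have c0 i : ((1 + 'X ^+ 2) ^+ i : {poly R})`_0 = 1.
  by rewrite -horner_coef0 horner_exp !hornerE expr0n addr0 expr1n.
elim: k => [|k IH]; first by rewrite expr0 coefC.
by rewrite exprSr mulrDr mulr1 coefD IH coefMXn/= c0 -natr1.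
Qed.

(** The rotation identity in t is available for nonzero t only; the values t = 1, 2, 3, ... are
    already more than the roots of a nonzero polynomial. *)
Lemma poly_eq0_on_nat (q : {poly R}) : (forall n : nat, q.[n.+1%:R] = 0) -> q = 0.
Proof.
move=> q0; apply: (@roots_geq_poly_eq0 _ _ [seq i.+1%:R | i <- iota 0 (size q)]).
- by apply/allP => _ /mapP[i _ ->]; apply/rootP.
- rewrite map_inj_in_uniq ?iota_uniq// => i j _ _ /eqP.
  by rewrite eqr_nat => /eqP[].
- by rewrite size_map size_iota.
Qed.

(* Coefficient of t^2 in the rotation identity for (z + t y)^(2k). *)
Lemma moment_mixed k : (0 < k)%N ->
  (2 * k - 1)%:R * psi (fun p => pz p ^+ (2 * k - 2) * py p ^+ 2) = moment (2 * k).
Proof.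
move=> k0; set n := (2 * k)%N.
pose K i : R := psi (fun p : pt R => pz p ^+ (n - i) * py p ^+ i).
have bK i : bm (fun p : pt R => pz p ^+ (n - i) * py p ^+ i).
  by apply: bmM; apply: bmX; [exact: bm_pz|exact: bm_py].
(* Difference of the two sides of sum_i C(n,i) K_i t^i = M_n (1 + t^2)^k, the rotation identity
   multiplied by (1 + t^2)^k. *)
pose q : {poly R} := \poly_(i < n.+1) ('C(n, i)%:R * K i)
  - moment n *: (1 + 'X ^+ 2) ^+ k.
have q0 : q = 0.
  apply: poly_eq0_on_nat => j; set t : R := j.+1%:R.
  have t0 : 0 < t by rewrite ltr0n.
  have d0 : 0 < 1 + t ^+ 2 by rewrite ltr_wpDr ?sqr_ge0.
  (* Cosine and sine of the rotation are c and t c, the direction (1, t) scaled to length 1. *)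
  pose c := (Num.sqrt (1 + t ^+ 2))^-1.
  have c2 : c ^+ 2 = (1 + t ^+ 2)^-1 by rewrite exprVn sqr_sqrtr ?ltW.
  have c0 : c != 0 by rewrite invr_eq0 gt_eqF// sqrtr_gt0.
  have cn : c ^+ n = (1 + t ^+ 2) ^- k by rewrite /n exprM c2 exprVn.
  have cs : c ^+ 2 + (t * c) ^+ 2 = 1 by rewrite exprMn c2; field; rewrite gt_eqF.
  have e := moment_rot c (t * c) n cs (mulf_neq0 (lt0r_neq0 t0) c0).
  rewrite /q hornerD hornerN hornerZ horner_exp horner_poly !hornerE.
  apply/eqP; rewrite subr_eq0; apply/eqP.
  rewrite -e.
  transitivity ((1 + t ^+ 2) ^+ k * \sum_(i < n.+1) (c ^+ n * ('C(n, i)%:R * t ^+ i)) * K i).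
    rewrite mulr_sumr; apply: eq_bigr => i _.
    rewrite !mulrA cn divff ?expf_neq0 ?gt_eqF// mul1r; ring.
  rewrite mulrC; congr (_ * _).
  rewrite -(eq_ball_integral (fun p => \sum_(i < n.+1) (c ^+ n * ('C(n, i)%:R * t ^+ i)) *
     (pz p ^+ (n - i) * py p ^+ i))).
    rewrite ball_integral_sum; last by move=> i; apply: bmM => //; exact: bm_cst.
    by apply: eq_bigr => i _; rewrite ball_integralZ.
  move=> p _; rewrite exprDn; apply: eq_bigr => i _.
  have -> : c ^+ n = c ^+ (n - i) * c ^+ i by rewrite -exprD subnK// -ltnS.
  rewrite -mulr_natr !exprMn; ring.
have : q`_2 = 0 by rewrite q0 coef0.
rewrite /q coefB coefZ coef2_1X2_exp coef_poly ifT; last by rewrite /n; move: k0; lia.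
rewrite bin2 => /eqP; rewrite subr_eq0 => /eqP.
(* The binomial C(2k, 2) = k (2k - 1) meets the coefficient k of t^2 in (1 + t^2)^k, and k
   cancels. *)
have -> : (n * n.-1)./2 = (k * (2 * k - 1))%N.
  by rewrite /n -mulnA mul2n doubleK -subn1.
rewrite natrM -mulrA (mulrC (moment n)) => /mulfI -> //.
by rewrite pnatr_eq0 -lt0n.
Qed.

Lemma moment_even k : (2 * k + 1)%:R * moment (2 * k) = 4 / 3 * pi.
Proof.
elim: k => [|k IH].
  by rewrite muln0 mul1r /moment -[RHS]mul1r -ball_integral_cst.
have h := moment_mixed k.+1 isT.
have e2 : (2 * k.+1 - 2 = 2 * k)%N by lia.
have e1 : (2 * k.+1 - 1 = 2 * k + 1)%N by lia.
rewrite e2 e1 in h; set K := psi _ in h.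
have bz := bmX _ (2 * k) (@bm_pz R).
have bx := bmX _ 2 (@bm_px R); have by_ := bmX _ 2 (@bm_py R).
have bz2 := bmX _ 2 (@bm_pz R).
(* Exchanging x and y fixes z, so the weight x^2 contributes as much as y^2. *)
have hx : psi (fun p => pz p ^+ (2 * k) * px p ^+ 2) = K.
  rewrite -ball_integral_swap_xy//; exact: (bmM _ _ bz bx).1.
have hz : psi (fun p => pz p ^+ (2 * k) * pz p ^+ 2) = moment (2 * k.+1).
  by apply: eq_ball_integral => p _; rewrite -exprD mulnS addnC.
have : moment (2 * k) = K + K + moment (2 * k.+1).
  have s1 := ball_integralD _ _ (bmM _ _ bz bx) (bmM _ _ bz by_).
  have s2 := ball_integralD _ _ (bmD _ _ (bmM _ _ bz bx) (bmM _ _ bz by_)) (bmM _ _ bz bz2).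
  rewrite hx hz in s1 s2; rewrite -/K in s1; rewrite -s1 -s2.
  apply: eq_ball_integral => p /sphereP p1.
  by rewrite -!mulrDr -/(sqnorm p) p1 mulr1.
move=> e; rewrite -IH e -h.
have -> : (2 * k.+1 + 1)%:R = (2 * k + 1)%:R + 2 :> R by rewrite -natrD; congr _%:R; lia.
ring.
Qed.

Lemma momentE n : moment n = 2 / 3 * pi * ((1 - (-1) ^+ n.+1) / n.+1%:R).
Proof.
rewrite exprS mulN1r opprK -signr_odd.
have [on|en] := boolP (odd n).
  by rewrite moment_odd// expr1 subrr mul0r mulr0.
have := moment_even n./2; rewrite mul2n (even_halfK en) => h.
have n0 : (n.+1%:R : R) != 0 by rewrite pnatr_eq0.
rewrite expr0 addn1 in h *; apply: (mulfI n0); rewrite h.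
by field; rewrite -natr1 in n0.
Qed.

(** Archimedes' formula. Both sides are linear in the polynomial, so the monomials, that is the
    moments, decide. *)
Lemma ball_integral_poly (q : {poly R}) :
  psi (fun p => q.[pz p]) = 2 / 3 * pi * pint q.
Proof.
rewrite (eq_ball_integral _ (fun p => \sum_(i < size q) q`_i * pz p ^+ i)); last first.
  by move=> p _; rewrite horner_coef.
have bz i := bmX _ i (@bm_pz R).
rewrite ball_integral_sum; last by move=> i; apply: bmM => //; exact: bm_cst.
rewrite /pint mulr_sumr; apply: eq_bigr => i _.
by rewrite ball_integralZ// -/(moment i) momentE mulrCA.
Qed.

End Moments.

(** * Orthonormality of the spherical harmonics *)

Section ComplexMean.
Context {R : realType}.
Implicit Types (F G : pt R -> R[i]) (z w : R[i]).
Notation re := (@complex.Re R).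
Notation im := (@complex.Im R).

Lemma reD z w : re (z + w) = re z + re w. Proof. by case: z w => a b [c e]. Qed.
Lemma imD z w : im (z + w) = im z + im w. Proof. by case: z w => a b [c e]. Qed.
Lemma reM z w : re (z * w) = re z * re w - im z * im w.
Proof. by case: z w => a b [c e]. Qed.
Lemma imM z w : im (z * w) = re z * im w + im z * re w.
Proof. by case: z w => a b [c e]. Qed.
Lemma re_conj z : re (conjc z) = re z. Proof. by case: z. Qed.
Lemma im_conj z : im (conjc z) = - im z. Proof. by case: z. Qed.

Lemma cabs2E z : cabs2 z = re (z * conjc z).
Proof. by case: z => a b; rewrite /cabs2/= mulrN opprK -!expr2. Qed.

Definition cbm F := bm (fun p => re (F p)) /\ bm (fun p => im (F p)).

Lemma cbm_ext F G : F =1 G -> cbm F -> cbm G.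
Proof. by move=> /funext ->. Qed.

Lemma cbm_cst z : cbm (fun=> z).
Proof. by split; exact: bm_cst. Qed.

Lemma cbmD F G : cbm F -> cbm G -> cbm (fun p => F p + G p).
Proof.
move=> [rF iF] [rG iG]; split.
  by under eq_fun do rewrite reD; exact: bmD.
by under eq_fun do rewrite imD; exact: bmD.
Qed.

Lemma cbmM F G : cbm F -> cbm G -> cbm (fun p => F p * G p).
Proof.
move=> [rF iF] [rG iG]; split.
  under eq_fun do rewrite reM; apply: bmD; first exact: bmM.
  by apply: bmN; exact: bmM.
by under eq_fun do rewrite imM; apply: bmD; exact: bmM.
Qed.

Lemma cbm_conj F : cbm F -> cbm (fun p => conjc (F p)).
Proof.
move=> [rF iF]; split; first by under eq_fun do rewrite re_conj.
by under eq_fun do rewrite im_conj; exact: bmN.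
Qed.

Lemma cbmX F n : cbm F -> cbm (fun p => F p ^+ n).
Proof.
move=> bF; elim: n => [|n IH]; first exact: cbm_cst.
by apply: (cbm_ext (fun p => F p * F p ^+ n)) => [p|]; [rewrite exprS|exact: cbmM].
Qed.

Lemma cbm_sum (I : Type) (r : seq I) (F : I -> pt R -> R[i]) :
  (forall i, cbm (F i)) -> cbm (fun p => \sum_(i <- r) F i p).
Proof.
move=> bF; elim: r => [|i r IH].
  by apply: (cbm_ext (fun=> 0)) => [p|]; [rewrite big_nil|exact: cbm_cst].
apply: (cbm_ext (fun p => F i p + \sum_(j <- r) F j p)) => [p|].
  by rewrite big_cons.
exact: cbmD.
Qed.

Definition ball_cintegral F : R[i] :=
  Complex (psi (fun p => re (F p))) (psi (fun p => im (F p))).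
Local Notation cpsi := ball_cintegral.

Lemma eq_ball_cintegral F G : (forall p, sphere p -> F p = G p) -> cpsi F = cpsi G.
Proof. by move=> FG; congr Complex; apply: eq_ball_integral => p Sp; rewrite FG. Qed.

Lemma ball_cintegralD F G : cbm F -> cbm G ->
  cpsi (fun p => F p + G p) = cpsi F + cpsi G.
Proof.
move=> [rF iF] [rG iG]; congr Complex; rewrite -ball_integralD//.
  by apply: eq_ball_integral => p _; rewrite reD.
by apply: eq_ball_integral => p _; rewrite imD.
Qed.

Lemma ball_cintegralZ z F : cbm F -> cpsi (fun p => z * F p) = z * cpsi F.
Proof.
case: z => a b [rF iF]; congr Complex.
  rewrite -mulNr -!ball_integralZ// -ball_integralD; [|exact: bmM (bm_cst _) _..].
  by apply: eq_ball_integral => p _; rewrite reM/= mulNr.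
rewrite -!ball_integralZ// -ball_integralD; [|exact: bmM (bm_cst _) _..].
by apply: eq_ball_integral => p _; rewrite imM.
Qed.

Lemma ball_cintegral_sum (I : Type) (r : seq I) (F : I -> pt R -> R[i]) :
  (forall i, cbm (F i)) ->
  cpsi (fun p => \sum_(i <- r) F i p) = \sum_(i <- r) cpsi (F i).
Proof.
move=> bF; elim: r => [|i r IH].
  rewrite big_nil -[RHS](mul0r (cpsi (fun=> 0))) -ball_cintegralZ ?cbm_cst//.
    by apply: eq_ball_cintegral => p _; rewrite big_nil mul0r.
  exact: cbm_cst.
rewrite big_cons -IH -ball_cintegralD//; last exact: cbm_sum.
by apply: eq_ball_cintegral => p _; rewrite big_cons.
Qed.

(** Finite Parseval identity: the squared modulus expands into a complex double sum of which only
    the diagonal survives, and real parts are taken last. *)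
Lemma ball_integral_cabs2_orthonormal (I : finType) (y : I -> pt R -> R[i])
    (c : I -> R[i]) :
  (forall i, cbm (y i)) ->
  (forall i j, cpsi (fun p => y i p * conjc (y j p)) = ((i == j)%:R / 3)%R) ->
  psi (fun p => cabs2 (\sum_i c i * y i p)) = (\sum_i cabs2 (c i)) / 3.
Proof.
move=> by_ yy.
pose F p := \sum_i \sum_j (c i * conjc (c j)) * (y i p * conjc (y j p)).
have bF i j : cbm (fun p => y i p * conjc (y j p)) by apply: cbmM => //; exact: cbm_conj.
have bF' i j : cbm (fun p => (c i * conjc (c j)) * (y i p * conjc (y j p))).
  by apply: cbmM => //; exact: cbm_cst.
have -> : psi (fun p => cabs2 (\sum_i c i * y i p)) = re (cpsi F).
  apply: eq_ball_integral => p _; rewrite cabs2E; congr re.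
  rewrite rmorph_sum mulr_suml; apply: eq_bigr => i _.
  by rewrite mulr_sumr; apply: eq_bigr => j _; rewrite rmorphM/=; ring.
have -> : cpsi F = \sum_i (c i * conjc (c i)) / 3.
  rewrite ball_cintegral_sum; last by move=> i; exact: cbm_sum.
  apply: eq_bigr => i _; rewrite ball_cintegral_sum// (bigD1 i)//=.
  rewrite big1 ?addr0 => [|j ji]; rewrite ball_cintegralZ// yy.
    by rewrite eqxx mul1r.
  by rewrite eq_sym (negPf ji) mul0r mulr0.
rewrite (big_morph re reD (erefl _)) mulr_suml; apply: eq_bigr => i _.
have -> : (3^-1 : R[i]) = real_complex R 3^-1 by rewrite fmorphV rmorph_nat.
by rewrite reM cabs2E mulr0 subr0.
Qed.

End ComplexMean.
Local Notation cpsi := ball_cintegral.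

Section Orthonormality.
Context {R : realType}.
Notation re := (@complex.Re R).
Notation im := (@complex.Im R).
Implicit Types p : pt R.

Definition expi (t : R) : R[i] := Complex (cos t) (sin t).

Lemma expiD s t : expi (s + t) = expi s * expi t.
Proof. by rewrite /expi cosD sinD; congr Complex; rewrite addrC (mulrC (cos s)). Qed.

Lemma conj_expi t : conjc (expi t) = expi (- t).
Proof. by rewrite /expi cosN sinN. Qed.

Lemma expiX t n : expi t ^+ n = expi (n%:R * t).
Proof.
elim: n => [|n IH]; first by rewrite expr0 mul0r /expi cos0 sin0.
by rewrite exprS IH -expiD -natr1 mulrDl mul1r addrC.
Qed.

Lemma Ypos_rot t l m p :
  Ypos l m (rot_xy (cos t) (sin t) p) = expi (m%:R * t) * Ypos l m p.
Proof.
rewrite /Ypos /= mulrCA -expiX -exprMn; congr (_ * _ ^+ _).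
by congr Complex; rewrite /rot_xy /px /py /=; ring.
Qed.

(** Each harmonic is an eigenfunction of the rotations about the z-axis; conjugation carries this
    over to negative orders. *)
Lemma Y_rot t l (m : int) p :
  Y l m (rot_xy (cos t) (sin t) p) = expi (m%:~R * t) * Y l m p.
Proof.
rewrite /Y; case: (leP 0 m) => m0.
  by rewrite Ypos_rot natr_absz (ger0_norm m0).
have -> : m%:~R = - (`|m|%N%:R) :> R by rewrite natr_absz (ltr0_norm m0) rmorphN opprK.
rewrite Ypos_rot (rmorphM conjc) mulNr -conj_expi.
exact: mulrCA.
Qed.

Lemma bm_horner (q : {poly R}) : bm (fun p : pt R => q.[pz p]).
Proof.
rewrite (_ : (fun p => _) = (fun p => \sum_(i < size q) q`_i * pz p ^+ i)).
  by apply: bm_sum => i; apply: bmM (bm_cst _) (bmX _ _ bm_pz).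
by apply/funext => p; rewrite horner_coef.
Qed.

Lemma cbm_Y l (m : int) : cbm (@Y R l m).
Proof.
have bP k : cbm (@Ypos R l k).
  apply: cbmM; last by apply: cbmX; split; [exact: bm_px|exact: bm_py].
  by split; [exact: bmM (bm_cst _) (bm_horner _)|exact: bm_cst].
rewrite /Y; case: (0 <= m); first exact: bP.
by apply: cbmM; [exact: cbm_cst|apply: cbm_conj; exact: bP].
Qed.

Lemma Y_orthogonal l l' (m m' : int) : m != m' ->
  cpsi (fun p => Y l m p * conjc (Y l' m' p)) = 0.
Proof.
move=> mm'; set F := fun p => _.
have [rF iF] : cbm F by apply: cbmM; [|apply: cbm_conj]; exact: cbm_Y.
(* With (m - m') t = pi/2 the rotation multiplies the integrand by i. The factor -1 would require
   the angle pi when |m - m'| = 1, where the sine is 0. *)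
pose k : R := (m - m')%:~R; pose t : R := (pi / 2) / k.
have k0 : k != 0 by rewrite intr_eq0 subr_eq0.
have st : sin t != 0.
  have pos (j : R) : 1 <= j -> sin (pi / 2 / j) != 0.
    move=> j1; rewrite gt_eqF// sin_gt0_pi//.
    have j0 : 0 < j by exact: lt_le_trans j1.
    rewrite !divr_gt0 ?pi_gt0//= ltr_pdivrMr// ltr_pdivrMr//.
    by rewrite -mulrA ltr_pMr ?pi_gt0//; lra.
  have [kp|kn] := ltP 0 k.
    by apply: pos; rewrite /k -[1]/(1%:~R) ler_int -gtz0_ge1 -(ltr0z R).
  rewrite /t -[k]opprK invrN mulrN sinN oppr_eq0; apply: pos.
  rewrite /k -rmorphN -[1]/(1%:~R) ler_int -gtz0_ge1 -(ltr0z R) rmorphN.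
  by rewrite oppr_gt0 lt_neqAle k0.
have rotF p : F (rot_xy (cos t) (sin t) p) = Complex 0 1 * F p.
  rewrite /F !Y_rot (rmorphM conjc).
  have -> : Complex 0 1 = expi (m%:~R * t) * conjc (expi (m'%:~R * t)) :> R[i].
    rewrite conj_expi -expiD -mulrBl -rmorphB/= -/k /t mulrC divfK//.
    by rewrite /expi cos_pihalf sin_pihalf.
  exact: mulrACA.
clearbody F.
have h1 := ball_integral_rot_xy _ _ _ (cos2Dsin2 t) st rF.1.
have h2 := ball_integral_rot_xy _ _ _ (cos2Dsin2 t) st iF.1.
have r1 p : - im (F p) = re (F (rot_xy (cos t) (sin t) p)).
  by rewrite rotF reM/= mul0r sub0r mul1r.
have r2 p : re (F p) = im (F (rot_xy (cos t) (sin t) p)).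
  by rewrite rotF imM/= mul0r add0r mul1r.
(* Invariance of the integral I reads I = i I: its real part is minus its imaginary part and also
   equal to it. *)
have e1 : - psi (fun p => im (F p)) = psi (fun p => re (F p)) :=
  etrans (esym (ball_integralN _ iF)) (etrans (eq_ball_integral _ _ (fun p _ => r1 p)) h1).
have e2 : psi (fun p => re (F p)) = psi (fun p => im (F p)) :=
  etrans (eq_ball_integral _ _ (fun p _ => r2 p)) h2.
have i0 : psi (fun p => im (F p)) = 0 by move: e1; rewrite e2; lra.
by rewrite /ball_cintegral e2 i0.
Qed.

(** On the sphere (x + iy) (x - iy) = 1 - z^2, the value of -[wpoly]; hence the product is a real
    polynomial in z with the sign (-1)^k. *)
Lemma Ypos_mul_conj l l' k p : sphere p ->
  Ypos l k p * conjc (Ypos l' k p) = real_complex R (Ynorm R l k * Ynorm R l' k *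
   ((-1) ^+ k * (wpoly ^+ k * rodrigues R l' k * rodrigues R l k).[pz p])).
Proof.
move=> /sphereP p1; rewrite /Ypos.
set a := Ynorm R l k * _; set b := Ynorm R l' k * _.
have -> : conjc (real_complex R b * Complex (px p) (py p) ^+ k) =
    real_complex R b * Complex (px p) (- py p) ^+ k.
  rewrite (rmorphM conjc) (rmorphXn conjc); congr (_ * _); exact: conjc_real.
rewrite mulrACA -exprMn -rmorphM.
have -> : Complex (px p) (py p) * Complex (px p) (- py p) =
    real_complex R (- wpoly.[pz p]).
  rewrite /wpoly !hornerE -p1 /sqnorm.
  by congr Complex; rewrite /=; ring.
rewrite -rmorphXn -rmorphM /=; congr (real_complex R _).
rewrite /a /b !hornerM horner_exp (exprNn wpoly.[pz p]); ring.
Qed.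

Lemma Y_same_order l l' (m : int) : (`|m| <= l)%N -> (`|m| <= l')%N ->
  cpsi (fun p => Y l m p * conjc (Y l' m p)) = (l == l')%:R / 3.
Proof.
move=> ml ml'; set k := `|m|%N in ml ml' *.
pose q l l' := (-1) ^+ k *: (wpoly ^+ k * rodrigues R l' k * rodrigues R l k).
have -> : cpsi (fun p => Y l m p * conjc (Y l' m p)) = real_complex R
    (Ynorm R l k * Ynorm R l' k * (2 / 3 * pi * pint (q l l'))).
  rewrite -ball_integral_poly -ball_integralZ; last exact: bm_horner.
  have yy p : sphere p -> Y l m p * conjc (Y l' m p) =
      real_complex R (Ynorm R l k * Ynorm R l' k * (q l l').[pz p]).
    move=> Sp; rewrite /q hornerZ -Ypos_mul_conj//.
    (* For negative m the signs cancel and the conjugation changes sides; as the product is real and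
       symmetric, the polynomial is the same. *)
    rewrite /Y -/k; case: ifP => // _.
    have -> : conjc ((-1) ^+ k * conjc (Ypos l' k p)) = (-1) ^+ k * Ypos l' k p.
      rewrite (rmorphM conjc) (rmorphXn conjc) (rmorphN1 conjc); congr (_ * _).
      exact: conjcK.
    transitivity ((-1) ^+ k * (-1) ^+ k * (Ypos l' k p * conjc (Ypos l k p))).
      by ring.
    rewrite -expr2 sqrr_sign mul1r !Ypos_mul_conj//.
    by congr (real_complex R _); rewrite (mulrC (Ynorm R l' k)) -!mulrA (mulrC (rodrigues R l k)).
  rewrite /ball_cintegral; congr Complex.
    by apply: eq_ball_integral => p Sp; rewrite yy.
  rewrite -[RHS](mul0r (4 / 3 * pi)) -ball_integral_cst.
  by apply: eq_ball_integral => p Sp; rewrite yy.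
(* Symmetry in the two degrees reduces to the order demanded by [rodrigues_orthogonal]. *)
have qC l1 l2 : pint (q l1 l2) = pint (q l2 l1).
  by congr pint; rewrite /q -!mulrA (mulrC (rodrigues R l2 k)).
have main l1 l2 : (k <= l1)%N -> (k <= l2)%N -> (l2 <= l1)%N ->
    Ynorm R l1 k * Ynorm R l2 k * (2 / 3 * pi * pint (q l1 l2)) = (l1 == l2)%:R / 3.
  move=> k1 k2 l21; rewrite /q pintZ rodrigues_orthogonal//.
  have [e|ne] := eqVneq l1 l2; last by rewrite !mul0r !mulr0.
  rewrite -e /Ynorm -expr2 expr_div_n exprMn sqrr_sign mul1r sqr_sqrtr; last first.
    by rewrite !mulr_ge0 ?invr_ge0 ?ler0n// mulr_ge0// pi_ge0.
  have f1 : ((l1 + k)`!%:R : R) != 0 by rewrite pnatr_eq0 -lt0n fact_gt0.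
  have f2 : ((l1 - k)`!%:R : R) != 0 by rewrite pnatr_eq0 -lt0n fact_gt0.
  have f3 : ((2 * l1 + 1)%:R : R) != 0 by rewrite pnatr_eq0 addn1.
  have f4 : ((2 ^ l1 * l1`!)%:R : R) != 0.
    by rewrite pnatr_eq0 muln_eq0 expn_eq0/= -lt0n fact_gt0.
  have f5 : (pi : R) != 0 by rewrite gt_eqF ?pi_gt0.
  (* To be read with a = (l+k)!, b = (l-k)!, c = 2l+1, g = 2^l l! and u = pi. *)
  have gen (a b c g u : R) : a != 0 -> b != 0 -> c != 0 -> g != 0 -> u != 0 ->
    c / (4 * u) * b / a / g ^+ 2 * (2 / 3 * u * (1 * (g ^+ 2 * (2 / c) * (a / b)))) = 1 / 3.
    by move=> *; field; do ?[apply/andP; split].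
  exact: gen.
have [l'l|ll'] := leqP l' l; first by rewrite main//= fmorph_div !rmorph_nat.
rewrite (mulrC (Ynorm R l k)) qC main ?(ltnW ll')// fmorph_div !rmorph_nat.
by rewrite eq_sym.
Qed.

Lemma Y_orthonormal l l' (m m' : int) : (`|m| <= l)%N -> (`|m'| <= l')%N ->
  cpsi (fun p => Y l m p * conjc (Y l' m' p)) = ((l == l') && (m == m'))%:R / 3.
Proof.
have [->|mm'] := eqVneq m m'; first by rewrite andbT; exact: Y_same_order.
by rewrite andbF mul0r Y_orthogonal.
Qed.

End Orthonormality.

(** * Random fields *)

Lemma sphere_integral_bm {R : realType} (f : pt R -> R) : bm f ->
  sphere_integral f = (3 * psi f)%:E.
Proof. by move=> bf; exact: (f_equal (mule 3%:E) (ball_integralE _ bf)). Qed.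

Section RandomFields.
Context {d : measure_display} {Omega : measurableType d} {R : realType}.
Implicit Types (f g : Omega -> pt R -> R).

Lemma measurable_setT_sphere : measurable ([set: Omega] `*` @sphere R).
Proof. exact: measurableX measurableT measurable_sphere. Qed.

Lemma random_fieldD f g : random_field f -> random_field g ->
  random_field (fun w p => f w p + g w p).
Proof. exact: measurable_funD. Qed.

Lemma random_fieldM f g : random_field f -> random_field g ->
  random_field (fun w p => f w p * g w p).
Proof. exact: measurable_funM. Qed.

Lemma random_field_omega (h : Omega -> R) : measurable_fun setT h ->
  random_field (fun w _ => h w).
Proof.
move=> mh; apply: (measurable_funS measurableT (@subsetT _ _)).
exact: (measurableT_comp mh measurable_fst).
Qed.

Lemma random_field_sphere (h : pt R -> R) : measurable_fun setT h ->
  random_field (fun (_ : Omega) p => h p).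
Proof.
move=> mh; apply: (measurable_funS measurableT (@subsetT _ _)).
exact: (measurableT_comp mh measurable_snd).
Qed.

Lemma random_fieldN f : random_field f -> random_field (fun w p => - f w p).
Proof.
move=> mf; rewrite (_ : (fun w p => - f w p) = (fun w p => -1 * f w p)).
  by apply: random_fieldM mf; exact: random_field_omega (measurable_cst _).
by apply/funext => w; apply/funext => p; rewrite mulN1r.
Qed.

(* Nonnegative fields are handled through this everywhere defined function, so
   that Tonelli's theorem applies without restriction of domains. *)
Definition ball_extension f (wp : Omega * pt R) : \bar R :=
  ((fun p => (f wp.1 (normalize p))%:E) \_ (@ball3 R)) wp.2.
Notation ext := ball_extension.

Lemma sphere_integral_ext f w :
  sphere_integral (f w) = (3%:E * \int[@leb3 R]_p ext f (w, p))%E.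
Proof. exact: (f_equal (mule 3%:E) (integral_mkcond _ _)). Qed.

Lemma measurable_ext f : random_field f -> measurable_fun setT (ext f).
Proof.
move=> mf; pose D := [set: Omega] `*` @ball3 R.
have mD : measurable D by exact: measurableX measurableT measurable_ball3.
pose h (wp : Omega * pt R) := (f wp.1 (normalize wp.2))%:E.
have mh : measurable_fun D h.
  apply/measurable_EFinP.
  refine (@measurable_comp _ _ _ _ _ _ ([set: Omega] `*` @sphere R)
    (fun wp : Omega * pt R => f wp.1 wp.2) D (fun wp => (wp.1, normalize wp.2))
    measurable_setT_sphere _ mf _).
    by move=> _ [[w p] [_ bp] <-]; split => //; exact: normalize_sphere.
  apply: (measurable_funS measurableT (@subsetT _ _)).
  apply/measurable_fun_pair; first exact: measurable_fst.
  exact: (measurableT_comp measurable_normalize measurable_snd).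
rewrite (_ : ext f = h \_ D); first exact/(measurable_restrictT _ mD).
apply/funext => -[w p]; rewrite /ext !patchE /h /=.
have -> : ((w, p) \in D) = (p \in @ball3 R) => //.
by apply/idP/idP; rewrite !inE /D /=; [case|split].
Qed.

Lemma measurable_ext_section f w : random_field f ->
  measurable_fun setT (fun p => ext f (w, p)).
Proof.
move=> /measurable_ext mf.
refine (@measurableT_comp _ _ _ _ _ _ (ext f) setT (pair w) mf _).
exact: pair1_measurable.
Qed.

Lemma ext_ge0 f wp : (forall w p, 0 <= f w p) -> (0 <= ext f wp)%E.
Proof. by move=> f0; rewrite /ext patchE; case: ifP => // _; rewrite lee_fin. Qed.

Lemma measurable_ge0_integral_ext (h : Omega * pt R -> \bar R) :
  measurable_fun setT h -> (forall wp, 0 <= h wp)%E ->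
  measurable_fun setT (fun w => \int[@leb3 R]_p h (w, p))%E.
Proof. by move=> mh h0; exact: (@measurable_fun_fubini_tonelli_F _ _ _ _ _ (leb3_sf R) h mh h0). Qed.

(** Tonelli's theorem covers nonnegative integrands; positive and negative parts extend it to signed
    ones without integrability, as the coefficients require. *)
Lemma measurable_sphere_integral f : random_field f ->
  measurable_fun setT (fun w => sphere_integral (f w)).
Proof.
move=> /measurable_ext mf.
rewrite (_ : (fun w => _) = (fun w => 3%:E * (\int[@leb3 R]_p (ext f)^\+ (w, p) -
    \int[@leb3 R]_p (ext f)^\- (w, p)))%E); last first.
  apply/funext => w; rewrite sphere_integral_ext.
  refine (f_equal (mule 3%:E) (etrans (integralE _ _ _) _)).
  refine (f_equal2 (fun x y => x - y)%E _ _); apply: eq_integral => p _.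
    by rewrite !funeposE.
  by rewrite !funenegE.
apply: emeasurable_funM; first exact: measurable_cst.
apply: emeasurable_funB; apply: measurable_ge0_integral_ext => //.
  exact: measurable_funepos.
exact: measurable_funeneg.
Qed.

Lemma sphere_integral_ge0 (f : pt R -> R) : (forall p, 0 <= f p) ->
  (0 <= sphere_integral f)%E.
Proof.
by move=> f0; apply: mule_ge0 => //; apply: integral_ge0 => p _; rewrite lee_fin.
Qed.

Lemma sphere_integralD f g w : random_field f -> random_field g ->
  (forall w p, 0 <= f w p) -> (forall w p, 0 <= g w p) ->
  (sphere_integral (fun p => f w p + g w p)%R =
   sphere_integral (f w) + sphere_integral (g w))%E.
Proof.
move=> mf mg f0 g0; rewrite (sphere_integral_ext (fun w p => f w p + g w p)).
have e : (\int[@leb3 R]_p ext (fun w p => f w p + g w p)%R (w, p) =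
    \int[@leb3 R]_p (ext f (w, p) + ext g (w, p)))%E.
  apply: eq_integral => p _; rewrite /ext !patchE.
  by case: ifP => // _; rewrite adde0.
rewrite !sphere_integral_ext -ge0_muleDr.
- refine (f_equal (mule 3%:E) (etrans e _)).
  refine (@ge0_integralD _ _ _ (@leb3 R) _ measurableT _ _ _ _ _ _).
  + by move=> p _; exact: ext_ge0.
  + exact: measurable_ext_section.
  + by move=> p _; exact: ext_ge0.
  + exact: measurable_ext_section.
- by apply: integral_ge0 => p _; exact: ext_ge0.
- by apply: integral_ge0 => p _; exact: ext_ge0.
Qed.

Lemma le_sphere_integral f g w : random_field f -> random_field g ->
  (forall w p, 0 <= f w p) -> (forall w p, f w p <= g w p) ->
  (sphere_integral (f w) <= sphere_integral (g w))%E.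
Proof.
move=> mf mg f0 fg; rewrite !sphere_integral_ext lee_pmul2l//.
refine (@ge0_le_integral _ _ _ (@leb3 R) _ measurableT _ _ _ _ _ _).
- by move=> p _; exact: ext_ge0.
- exact: measurable_ext_section.
- exact: measurable_ext_section.
- move=> p _; rewrite /ext !patchE; case: ifP => // _.
  by rewrite lee_fin.
Qed.

Variable P : probability Omega R.

(** [L2sq] and [L2dist_sq] are instances up to unfolding, so additivity and monotonicity below serve
    both. *)
Definition field_integral f : \bar R := (\int[P]_w sphere_integral (f w))%E.
Local Notation J := field_integral.

Lemma field_integralD f g : random_field f -> random_field g ->
  (forall w p, 0 <= f w p) -> (forall w p, 0 <= g w p) ->
  J (fun w p => f w p + g w p)%R = (J f + J g)%E.
Proof.
move=> mf mg f0 g0.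
refine (etrans (eq_integral (fun w => sphere_integral (f w) + sphere_integral (g w))%E
  (fun w => sphere_integral (fun p => f w p + g w p)%R) _) _).
  by move=> w _; exact: sphere_integralD.
refine (@ge0_integralD _ _ _ P _ measurableT _ _ _ _ _ _).
- by move=> w _; exact: sphere_integral_ge0.
- exact: measurable_sphere_integral.
- by move=> w _; exact: sphere_integral_ge0.
- exact: measurable_sphere_integral.
Qed.

Lemma le_field_integral f g : random_field f -> random_field g ->
  (forall w p, 0 <= f w p) -> (forall w p, f w p <= g w p) -> (J f <= J g)%E.
Proof.
move=> mf mg f0 fg; refine (@ge0_le_integral _ _ _ P _ measurableT _ _ _ _ _ _).
- by move=> w _; exact: sphere_integral_ge0.
- exact: measurable_sphere_integral.
- exact: measurable_sphere_integral.
- by move=> w _; exact: le_sphere_integral.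
Qed.

Lemma field_integral_ge0 f : (forall w p, 0 <= f w p) -> (0 <= J f)%E.
Proof. by move=> f0; apply: integral_ge0 => w _; exact: sphere_integral_ge0. Qed.

End RandomFields.
Local Notation J := field_integral.

(** * The truncation error *)

Lemma normr_midx l (j : 'I_(2 * l + 1)) : (`|midx j| <= l)%N.
Proof. by rewrite /midx; case: j => j /= jl; lia. Qed.

Section Parseval.
Context {R : realType}.

(** The double sum over l and m is reindexed by the dependent pairs (l, j), one finite type on which
    the harmonics form a single orthonormal family. *)
Lemma sphere_integral_Y_sum (L : nat) (c : nat -> int -> R[i]) :
  sphere_integral (fun p => cabs2 (\sum_(l < L.+1) \sum_(j < 2 * l + 1)
    c l (midx j) * Y l (midx j) p)) =
  (\sum_(l < L.+1) \sum_(j < 2 * l + 1) cabs2 (c l (midx j)))%:E.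
Proof.
pose I := {l : 'I_L.+1 & 'I_(2 * l + 1)}.
pose y (i : I) p := @Y R (tag i) (midx (tagged i)) p.
pose z (i : I) := c (tag i) (midx (tagged i)).
have yb (i : I) : cbm (y i) by exact: cbm_Y.
have yy (i j : I) : cpsi (fun p => y i p * conjc (y j p)) = (i == j)%:R / 3.
  rewrite Y_orthonormal ?normr_midx//; congr ((nat_of_bool _)%:R / _).
  apply/idP/eqP => [|->]; last by rewrite !eqxx.
  case: i j => [l i] [l' j] /= /andP[/eqP/val_inj ll'].
  subst l'; rewrite /midx => /eqP/addIr [] ij.
  by congr existT; exact: val_inj.
have e : (fun p => cabs2 (\sum_(l < L.+1) \sum_(j < 2 * l + 1)
    c l (midx j) * Y l (midx j) p)) = (fun p => cabs2 (\sum_i z i * y i p)).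
  apply/funext => p; congr cabs2.
  exact: (sig_big_dep _ _ (fun l j => c (val l) (midx j) * Y (val l) (midx j) p)).
have bz (F : pt R -> R[i]) : cbm F -> bm (fun p => cabs2 (F p)).
  by move=> [rF iF]; apply: bmD; exact: bmX.
rewrite e sphere_integral_bm; last first.
  by apply: bz; apply: cbm_sum => i; apply: cbmM => //; exact: cbm_cst.
rewrite (ball_integral_cabs2_orthonormal _ y z yb yy); congr EFin.
rewrite mulrC divfK//; apply/esym.
exact: (sig_big_dep _ _ (fun l j => cabs2 (c (val l) (midx j)))).
Qed.

End Parseval.

(** * Complex random fields and block soft thresholding *)

Section ComplexFields.
Context {d : measure_display} {Omega : measurableType d} {R : realType}.
Notation re := (@complex.Re R).
Notation im := (@complex.Im R).
Implicit Types (F G : Omega -> pt R -> R[i]) (z : Omega -> R[i]).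

Definition complex_random_field F :=
  random_field (fun w p => re (F w p)) /\ random_field (fun w p => im (F w p)).
Local Notation crf := complex_random_field.

Definition measurable_complex z :=
  measurable_fun setT (fun w => re (z w)) /\ measurable_fun setT (fun w => im (z w)).

Lemma eq_random_field (f g : Omega -> pt R -> R) :
  (forall w p, f w p = g w p) -> random_field f -> random_field g.
Proof. by move=> fg; rewrite (_ : f = g)//; apply/funext => w; apply/funext. Qed.

Lemma crfD F G : crf F -> crf G -> crf (fun w p => F w p + G w p).
Proof.
move=> [rF iF] [rG iG]; split.
  by apply: eq_random_field (random_fieldD _ _ rF rG) => w p; rewrite reD.
by apply: eq_random_field (random_fieldD _ _ iF iG) => w p; rewrite imD.
Qed.

Lemma crfN F : crf F -> crf (fun w p => - F w p).
Proof.
have reN (u : R[i]) : re (- u) = - re u by case: u.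
have imN (u : R[i]) : im (- u) = - im u by case: u.
move=> [rF iF]; split.
  by apply: eq_random_field (random_fieldN _ rF) => w p; rewrite reN.
by apply: eq_random_field (random_fieldN _ iF) => w p; rewrite imN.
Qed.

Lemma crf_real (T : Omega -> pt R -> R) : random_field T ->
  crf (fun w p => real_complex R (T w p)).
Proof.
by move=> mT; split => //; exact: random_field_omega (measurable_cst _).
Qed.

Lemma crf_coef z (F : pt R -> R[i]) : measurable_complex z -> cbm F ->
  crf (fun w p => z w * F p).
Proof.
move=> [rz iz] [[rF _] [iF _]].
have rr := random_fieldM _ _ (random_field_omega _ rz) (random_field_sphere _ rF).
have ri := random_fieldM _ _ (random_field_omega _ rz) (random_field_sphere _ iF).
have ir := random_fieldM _ _ (random_field_omega _ iz) (random_field_sphere _ rF).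
have ii := random_fieldM _ _ (random_field_omega _ iz) (random_field_sphere _ iF).
split.
  apply: eq_random_field (random_fieldD _ _ rr (random_fieldN _ ii)) => w p.
  by rewrite reM.
by apply: eq_random_field (random_fieldD _ _ ri ir) => w p; rewrite imM.
Qed.

Lemma crf_sum (I : Type) (r : seq I) (F : I -> Omega -> pt R -> R[i]) :
  (forall i, crf (F i)) -> crf (fun w p => \sum_(i <- r) F i w p).
Proof.
move=> cF; elim: r => [|i r IH].
  rewrite (_ : (fun w p => _) = (fun w p => 0)).
    by split; exact: random_field_omega (measurable_cst _).
  by apply/funext => w; apply/funext => p; rewrite big_nil.
rewrite (_ : (fun w p => _) = (fun w p => F i w p + \sum_(j <- r) F j w p)).
  exact: crfD.
by apply/funext => w; apply/funext => p; rewrite big_cons.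
Qed.

Lemma crf_psum (a : nat -> int -> Omega -> R[i]) L :
  (forall l m, measurable_complex (a l m)) -> crf (psum a L).
Proof.
move=> ma; apply: crf_sum => l; apply: crf_sum => j.
by apply: crf_coef => //; exact: cbm_Y.
Qed.

Lemma random_field_cabs2 F : crf F -> random_field (fun w p => cabs2 (F w p)).
Proof.
move=> [rF iF].
have := random_fieldD _ _ (random_fieldM _ _ rF rF) (random_fieldM _ _ iF iF).
by apply: eq_random_field => w p; rewrite /cabs2 !expr2.
Qed.

Lemma measurable_coef (T : Omega -> pt R -> R) l m : random_field T ->
  measurable_complex (coef T l m).
Proof.
move=> mT; have [rY0 iY0] := @cbm_Y R l m; have rY := rY0.1; have iY := iY0.1.
have mf (h : pt R -> R) : measurable_fun setT h ->
    measurable_fun setT (fun w => fine (sphere_integral (fun p => T w p * h p))).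
  move=> mh; apply: (measurableT_comp (fine_measurable measurableT)).
  apply: (measurable_sphere_integral (fun w p => T w p * h p)).
  exact: (random_fieldM _ _ mT (random_field_sphere _ mh)).
split; first exact: mf rY.
exact: (measurableT_comp (@oppr_measurable R setT) (mf _ iY)).
Qed.

Variable a : nat -> int -> Omega -> R[i].
Hypothesis ma : forall l m, measurable_complex (a l m).

Lemma sqr_Acoef l w : Acoef a l w ^+ 2 = \sum_(j < 2 * l + 1) cabs2 (a l (midx j) w).
Proof. by rewrite sqr_sqrtr// sumr_ge0// => j _; rewrite addr_ge0 ?sqr_ge0. Qed.

Lemma measurable_Acoef l : measurable_fun setT (Acoef a l).
Proof.
apply: (measurableT_comp measurable_fun_sqrt).
apply: measurable_sum => j; have [mr mi] := ma l (midx j).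
by apply: measurable_funD; exact: measurable_funX.
Qed.

Lemma measurable_reg_coef lam beta l m :
  measurable_complex (reg_coef lam beta a l m).
Proof.
have mA := measurable_Acoef l; have [mr mi] := ma l m.
have mV : measurable_fun setT (fun w => (Acoef a l w)^-1).
  rewrite (_ : (fun w => _) = (fun x => x `^ (-1)) \o Acoef a l); last first.
    by apply/funext => p /=; rewrite powR_inv1// sqrtr_ge0.
  exact: (measurableT_comp (measurable_powR (-1)) mA).
(* The real shrinkage factor of the whole block, set to 0 below the threshold. *)
pose f w := if lam * beta l < Acoef a l w then 1 - lam * beta l / Acoef a l w else 0.
have mf : measurable_fun setT f.
  apply: measurable_fun_ifT; last exact: measurable_cst.
    by apply: measurable_fun_ltr => //; exact: measurable_cst.
  apply: measurable_funB; first exact: measurable_cst.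
  by apply: measurable_funM => //; exact: measurable_cst.
have e w : reg_coef lam beta a l m w = real_complex R (f w) * a l m w.
  by rewrite /reg_coef /f; case: ifP => // _; rewrite rmorph0 mul0r.
split.
  under eq_fun do rewrite e reM /= mul0r subr0.
  exact: measurable_funM.
under eq_fun do rewrite e imM /= mul0r addr0.
exact: measurable_funM.
Qed.

(** Above the threshold a block of norm A loses the fraction [lam * beta l] / A of itself, an error
    of norm [lam * beta l]; below, it is lost entirely, an error of norm A. *)
Lemma reg_coef_dist lam beta l w : 0 <= lam * beta l ->
  \sum_(j < 2 * l + 1) cabs2 (a l (midx j) w - reg_coef lam beta a l (midx j) w) =
  Num.min (lam * beta l) (Acoef a l w) ^+ 2.
Proof.
move=> lb0; rewrite /reg_coef; have [lt|Al] := ltP (lam * beta l); last first.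
  rewrite sqr_Acoef.
  by apply: eq_bigr => j _; rewrite subr0.
have A0 : Acoef a l w != 0 by rewrite gt_eqF// (le_lt_trans lb0).
transitivity ((lam * beta l / Acoef a l w) ^+ 2 * Acoef a l w ^+ 2).
  rewrite sqr_Acoef mulr_sumr; apply: eq_bigr => j _.
  set t := lam * beta l / _; case: (a l (midx j) w) => x y.
  have -> : Complex x y - real_complex R (1 - t) * Complex x y =
      Complex (t * x) (t * y).
    by congr Complex; rewrite /=; ring.
  by rewrite /cabs2/= !exprMn -mulrDr.
by rewrite -exprMn divfK.
Qed.

End ComplexFields.
Local Notation crf := complex_random_field.

(** Two uses of |u+v|^2 <= 2|u|^2 + 2|v|^2 on s - t = (z - u) + ((s - z) - (t - u)). The factors 2
    are written as repeated sums, so that additivity of the integral is all that is needed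
    afterwards. *)
Lemma sqr_dist_le {R : realType} (s t : R) (z u : R[i]) :
  (s - t) ^+ 2 <= (cabs2 (z - u) +
      ((cabs2 (real_complex R s - z) + cabs2 (real_complex R t - u)) +
       (cabs2 (real_complex R s - z) + cabs2 (real_complex R t - u)))) +
    (cabs2 (z - u) +
      ((cabs2 (real_complex R s - z) + cabs2 (real_complex R t - u)) +
       (cabs2 (real_complex R s - z) + cabs2 (real_complex R t - u)))).
Proof.
case: z u => a b [c e]; rewrite /cabs2 !reD !imD /= -subr_ge0.
set X := (X in 0 <= X).
(* The gap is a sum of squares: the parallelogram law, used twice on the real parts, and what the
   imaginary parts leave. *)
have -> : X = ((a - c) - ((s - a) - (t - c))) ^+ 2 + 2 * ((s - a) + (t - c)) ^+ 2 +
    2 * (b - e) ^+ 2 + 4 * b ^+ 2 + 4 * e ^+ 2 by rewrite /X; ring.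
have := sqr_ge0 ((a - c) - ((s - a) - (t - c))).
have := sqr_ge0 ((s - a) + (t - c)).
have := sqr_ge0 (b - e); have := sqr_ge0 b; have := sqr_ge0 e.
by move=> *; lra.
Qed.

Section TruncationError.
Context {d : measure_display} {Omega : measurableType d} {R : realType}.
Variables (P : probability Omega R) (a : nat -> int -> Omega -> R[i]).
Hypothesis ma : forall l m, measurable_complex (a l m).
Variables (lam : R) (beta : nat -> R).
Hypotheses (lam_ge0 : 0 <= lam) (beta_ge0 : forall l, 0 <= beta l).
Notation ar := (reg_coef lam beta a).
Notation D := (fun l w => Num.min (lam * beta l) (Acoef a l w) ^+ 2).

Lemma lambeta_ge0 l : 0 <= lam * beta l.
Proof. exact: mulr_ge0. Qed.

Lemma min_ge0 l w : 0 <= Num.min (lam * beta l) (Acoef a l w).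
Proof. by rewrite le_min lambeta_ge0 sqrtr_ge0. Qed.

Lemma measurable_min_sqr l : measurable_fun setT (fun w => (D l w)%:E).
Proof.
apply/measurable_EFinP; apply: measurable_funX; apply: measurable_minr.
  exact: measurable_cst.
exact: measurable_Acoef ma l.
Qed.

Lemma psum_dist_integral L :
  J P (fun w p => cabs2 (psum a L w p - psum ar L w p)) =
  (\sum_(l < L.+1) \int[P]_w (D l w)%:E)%E.
Proof.
transitivity (\int[P]_w (\sum_(l < L.+1) (D l w)%:E)%E)%E.
  apply: eq_integral => w _.
  transitivity (sphere_integral (fun p => cabs2 (\sum_(l < L.+1)
     \sum_(j < 2 * l + 1) (a l (midx j) w - ar l (midx j) w) * Y l (midx j) p))).
    congr sphere_integral; apply/funext => p; congr cabs2.
    rewrite /psum -sumrB; apply: eq_bigr => l _.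
    by rewrite -sumrB; apply: eq_bigr => j _; rewrite mulrBl.
  rewrite (sphere_integral_Y_sum L (fun l m => a l m w - ar l m w)) sumEFin.
  congr EFin; apply: eq_bigr => l _.
  exact: (reg_coef_dist a lam beta l w (lambeta_ge0 l)).
refine (@ge0_integral_sum _ _ _ P _ measurableT _
  (fun (l : 'I_L.+1) w => (D l w)%:E) _ _ _).
  by move=> l; exact: measurable_min_sqr.
by move=> l w _; rewrite lee_fin sqr_ge0.
Qed.

Lemma min_sqr_integral_le_cst l :
  (\int[P]_w (D l w)%:E <= ((lam * beta l) ^+ 2)%:E)%E.
Proof.
have -> : ((lam * beta l) ^+ 2)%:E = (\int[P]_w (cst ((lam * beta l) ^+ 2)%:E w))%E.
  apply/esym/(etrans (integral_cst P measurableT _)).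
  exact: (etrans (f_equal (mule _) (probability_setT P)) (mule1 _)).
apply: ge0_le_integral => //.
- by move=> w _; rewrite lee_fin sqr_ge0.
- exact: measurable_min_sqr.
- by move=> w _; rewrite lee_fin lerXn2r ?nnegrE ?min_ge0 ?lambeta_ge0// ge_min lexx.
Qed.

Lemma min_sqr_integral_le_Acoef l :
  (\int[P]_w (D l w)%:E <= \int[P]_w ((Acoef a l w) ^+ 2)%:E)%E.
Proof.
apply: ge0_le_integral => //.
- by move=> w _; rewrite lee_fin sqr_ge0.
- exact: measurable_min_sqr.
- by apply/measurable_EFinP; apply: measurable_funX; exact: measurable_Acoef ma l.
- move=> w _; rewrite lee_fin lerXn2r ?nnegrE ?min_ge0 ?sqrtr_ge0//.
  by rewrite ge_min lexx orbT.
Qed.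

(** Degrees up to [lstar] are charged to the threshold, higher ones to the tail of the energy. The
    bound does not depend on [L] and therefore survives the limit. *)
Lemma truncation_error_le (lstar : nat) (t : \bar R) L : (lstar <= L)%N ->
  (tailEA P a lstar <= t)%E ->
  (J P (fun w p => cabs2 (psum a L w p - psum ar L w p)%R) <=
   (lam ^+ 2 * \sum_(l < lstar.+1) beta l ^+ 2)%R%:E + t)%E.
Proof.
move=> lL tl; rewrite psum_dist_integral.
rewrite -(big_mkord xpredT (fun l => \int[P]_w (D l w)%:E)%E).
rewrite (@big_cat_nat _ _ _ lstar.+1)//=; apply: leeD.
  rewrite big_mkord mulr_sumr -sumEFin; apply: lee_sum => l _.
  by rewrite -exprMn min_sqr_integral_le_cst.
apply: le_trans tl; apply: (@le_trans _ _
  (\sum_(lstar.+1 <= l < L.+1) \int[P]_w ((Acoef a l w) ^+ 2)%:E)%E).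
  by apply: lee_sum => l _; exact: min_sqr_integral_le_Acoef.
apply: nneseries_lim_ge => l _ _; apply: integral_ge0 => w _.
by rewrite lee_fin sqr_ge0.
Qed.

End TruncationError.

(** * Passage to the limit *)

Lemma cvgn_EFinD {R : realType} (u v : nat -> \bar R) (x y : R) :
  u L @[L --> \oo] --> x%:E -> v L @[L --> \oo] --> y%:E ->
  (u L + v L)%E @[L --> \oo] --> (x + y)%:E.
Proof. by move=> ux vy; rewrite EFinD; apply: cvgeD. Qed.

Theorem theorem5p2 (d : measure_display) (Omega : measurableType d)
  (R : realType) (P : probability Omega R)
  (To : Omega -> pt R -> R)
  (To_rf : random_field To)
  (To_L2 : (L2sq P To < +oo)%E)
  (To_exp : L2dist_sq P To (psum (coef To) L) @[L --> \oo] --> 0%E)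
  (eps : R) (eps_gt0 : 0 < eps)
  (beta : nat -> R) (beta_gt0 : forall l, 0 < beta l)
  (lstar : nat)
  (lstar_tail : (tailEA P (coef To) lstar <= (eps ^+ 2 / 4)%:E)%E)
  (lstar_min : forall k, (k < lstar)%N ->
                 ~ (tailEA P (coef To) k <= (eps ^+ 2 / 4)%:E)%E)
  (lam : R) (lam_ge0 : 0 <= lam)
  (lam_lt : lam < eps / (2 * Num.sqrt (\sum_(l < lstar.+1) beta l ^+ 2)))
  (Tr : Omega -> pt R -> R)
  (Tr_rf : random_field Tr)
  (Tr_exp : L2dist_sq P Tr (psum (reg_coef lam beta (coef To)) L) @[L --> \oo]
              --> 0%E) :
  (L2norm P (fun w p => (To w p - Tr w p)%R) < eps%:E)%E.
Proof.
set a := coef To in To_exp lstar_tail lstar_min Tr_exp.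
have ma l m : measurable_complex (a l m) by exact: measurable_coef.
have mar l m : measurable_complex (reg_coef lam beta a l m).
  exact: measurable_reg_coef.
have beta_ge0 l : 0 <= beta l by exact: ltW.
set S := \sum_(l < lstar.+1) beta l ^+ 2 in lam_lt.
have S0 : 0 < S.
  by rewrite /S big_ord_recl ltr_wpDr ?exprn_gt0// sumr_ge0// => l _; rewrite sqr_ge0.
(* [s0] bounds the truncation errors from degree [lstar] on. Squaring [lam_lt] gives [lam ^+ 2 * S]
   < eps^2/4, the source of the strict inequality in the conclusion. *)
pose s0 : R := lam ^+ 2 * S + eps ^+ 2 / 4.
have s0_lt : s0 + s0 < eps ^+ 2.
  have qS : 0 < Num.sqrt S by rewrite sqrtr_gt0.
  have h1 : lam * (2 * Num.sqrt S) < eps by rewrite -ltr_pdivlMr// mulr_gt0.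
  have h2 : (lam * (2 * Num.sqrt S)) ^+ 2 < eps ^+ 2.
    have e0 := ltW eps_gt0.
    have l0 : 0 <= lam * (2 * Num.sqrt S) by rewrite !mulr_ge0// ltW.
    by rewrite ltr_pXn2r.
  have : (lam * (2 * Num.sqrt S)) ^+ 2 = 4 * (lam ^+ 2 * S).
    by rewrite !exprMn sqr_sqrtr ?ltW//; ring.
  by rewrite /s0; lra.
pose U L w p := cabs2 (psum a L w p - psum (reg_coef lam beta a) L w p).
pose Vo L w p := cabs2 (real_complex R (To w p) - psum a L w p).
pose Vr L w p := cabs2 (real_complex R (Tr w p) - psum (reg_coef lam beta a) L w p).
have c0 (z : R[i]) : 0 <= cabs2 z by rewrite addr_ge0 ?sqr_ge0.
have mU L : random_field (U L).
  by apply: random_field_cabs2; apply: crfD; [exact: crf_psum|apply: crfN; exact: crf_psum].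
have mVo L : random_field (Vo L).
  by apply: random_field_cabs2; apply: crfD; [exact: crf_real|apply: crfN; exact: crf_psum].
have mVr L : random_field (Vr L).
  by apply: random_field_cabs2; apply: crfD; [exact: crf_real|apply: crfN; exact: crf_psum].
pose V L w p := Vo L w p + Vr L w p.
(* [W + W] is literally the right-hand side of [sqr_dist_le]. *)
pose W L w p := U L w p + (V L w p + V L w p).
have mV L : random_field (V L) by exact: random_fieldD.
have V0 L w p : 0 <= V L w p by exact: addr_ge0 (c0 _) (c0 _).
have VV0 L w p : 0 <= V L w p + V L w p by exact: addr_ge0 (V0 _ _ _) (V0 _ _ _).
have mVV L : random_field (fun w p => V L w p + V L w p) by exact: random_fieldD.
have mW L : random_field (W L) by exact: random_fieldD.
have W0 L w p : 0 <= W L w p by exact: addr_ge0 (c0 _) (VV0 _ _ _).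
pose v L : \bar R := (L2dist_sq P To (psum a L) + L2dist_sq P Tr (psum (reg_coef lam beta a) L))%E.
have JW L : J P (W L) = (J P (U L) + (v L + v L))%E.
  have JV : J P (V L) = v L :=
    field_integralD P _ _ (mVo L) (mVr L) (fun w p => c0 _) (fun w p => c0 _).
  have JVV := field_integralD P _ _ (mV L) (mV L) (V0 L) (V0 L).
  have JUV := field_integralD P _ _ (mU L) (mVV L) (fun w p => c0 _) (VV0 L).
  exact: (etrans JUV (f_equal (adde _) (etrans JVV (f_equal2 adde JV JV)))).
have bound L : (lstar <= L)%N -> (L2sq P (fun w p => (To w p - Tr w p)%R) <=
    (s0%:E + (v L + v L)) + (s0%:E + (v L + v L)))%E.
  move=> lL; have JU : (J P (U L) <= s0%:E)%E.
    by apply: le_trans (truncation_error_le P a ma lam beta lam_ge0 beta_ge0 _ _ _ lL lstar_tail) _.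
  have mdiff : random_field (fun w p => (To w p - Tr w p) ^+ 2).
    have mD := random_fieldD _ _ To_rf (random_fieldN _ Tr_rf).
    by apply: eq_random_field (random_fieldM _ _ mD mD) => w p; rewrite expr2.
  have le1 : (J P (fun w p => ((To w p - Tr w p) ^+ 2)%R) <= J P (fun w p => (W L w p + W L w p)%R))%E.
    apply: le_field_integral => // [|w p|w p].
    - exact: random_fieldD.
    - exact: sqr_ge0.
    - exact: sqr_dist_le.
  apply: (le_trans le1).
  have JWW := field_integralD P _ _ (mW L) (mW L) (W0 L) (W0 L).
  rewrite JWW JW; apply: leeD; apply: leeD => //.
(* The remainders [v] tend to 0, so the bound tends to [s0 + s0] while the left-hand side does not
   depend on [L]. *)
have v_cvg := cvgn_EFinD _ _ 0 0 To_exp Tr_exp.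
rewrite -/v addr0 in v_cvg; clearbody v.
have vv_cvg := cvgn_EFinD _ _ _ _ v_cvg v_cvg.
have s0_cvg : s0%:E @[_ --> \oo] --> s0%:E by exact: cvg_cst.
have sv_cvg := cvgn_EFinD _ _ _ _ s0_cvg vv_cvg.
have bound_cvg := cvgn_EFinD _ _ _ _ sv_cvg sv_cvg.
rewrite !addr0 in bound_cvg.
have lim_le : (L2sq P (fun w p => (To w p - Tr w p)%R) <= (s0 + s0)%:E)%E.
  apply: (cvge_to_ge bound_cvg).
  by exists lstar => // L /= lL; exact: bound.
have L2_ge0 : (0 <= L2sq P (fun w p => (To w p - Tr w p)%R))%E.
  by apply: field_integral_ge0 => w p; exact: sqr_ge0.
(* The bound excludes an infinite value, so the power 1/2 is a real square root and squares can be
   compared. *)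
rewrite /L2norm; move: lim_le L2_ge0.
case: (L2sq P _) => [q| |]//; rewrite !lee_fin => qs q0.
rewrite poweR_EFin lte_fin powR12_sqrt// -(ger0_norm (ltW eps_gt0)) -sqrtr_sqr.
by rewrite ltr_sqrt ?exprn_gt0//; exact: le_lt_trans s0_lt.
Qed.
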